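(* For any prime power $q$, there exists an abelian $\mathrm{GQ}(q,q^2)$ over the cyclic group $\mathbb{Z}_{q+1}$; that is, there exists a $\mathrm{GQ}(q,q^2)$ having an incidence matrix of the form $$\begin{bmatrix} I_{q^3+1}\otimes\mathbf{1}_{q+1}^{\mathrm T}\\ \Phi(T)\end{bmatrix}$$ where $\Phi(z)$ is a $(q^3+1,q+1,q+1)$-polyphase BIBD ETF over $\mathbb{Z}_{q+1}$. As such, letting $\Phi(z)$ be the corresponding $(q^3+1,q+1,q+1)$-polyphase BIBD ETF: (a) For any nontrivial character $\gamma$ of $\mathbb{Z}_{q+1}$, $|\Phi(\gamma)|^2$ is the incidence matrix of a $\mathrm{BIBD}(q^3+1,q+1,1)$ and the columns of $\Phi(\gamma)$ form an ETF of $n$ vectors for their $d$-dimensional span, where $d=q(q^2-q+1)$, $n=q^3+1$, $n-d=q^2-q+1$. (b) When $q$ is odd, $\gamma$ can be chosen so that $\Phi(\gamma)$ is a real ETF. (c) $\Phi^*(z)\Phi(z)-q^2I$ is an abelian $(q^3+1,q+1,q^2-1)$-DRACKN.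
   Context: **Polyphase matrices.** For a finite abelian group $\mathcal{G}$ (written additively), elements of the group ring $\mathbb{C}\mathcal{G}$ are written as formal polynomials $x(z)=\sum_{g\in\mathcal{G}}x(g)z^g$ with $x(g)\in\mathbb{C}$, multiplied by $z^{g_1}z^{g_2}=z^{g_1+g_2}$; the multiplicative identity is $1=z^0$. A monomial over $\mathcal{G}$ is an element $z^g$. The conjugate of $x(z)$ is $\overline{x(z)}:=\sum_{g}\overline{x(-g)}z^g$. A polyphase matrix over $\mathcal{G}$ is a matrix with entries in $\mathbb{C}\mathcal{G}$; $\Phi^*(z)$ is the matrix whose $(j,i)$ entry is the conjugate of the $(i,j)$ entry of $\Phi(z)$, and self-adjoint means $A^*(z)=A(z)$. $|\Phi(z)|^2$ is the matrix whose entries are $\overline{x(z)}x(z)$, where $x(z)$ is the corresponding entry of $\Phi(z)$; for a complex matrix, $|\cdot|^2$ is the entrywise squared modulus. Scalar matrices are regarded as polyphase matrices with constant entries. A character of $\mathcal{G}$ is a homomorphism $\gamma:\mathcal{G}\to\{\zeta\in\mathbb{C}:|\zeta|=1\}$; $x(\gamma):=\sum_g x(g)\gamma(g)$, and $\Phi(\gamma)$ is obtained by applying this entrywise. For $g\in\mathcal{G}$, $T^g$ is the $\mathcal{G}\times\mathcal{G}$ permutation matrix of the translation $(T^g y)(g')=y(g'-g)$ on $\mathbb{C}^{\mathcal{G}}$. $\Phi(T)$ is the block matrix obtained from $\Phi(z)$ by replacing each entry $\sum_g x(g)z^g$ by the $|\mathcal{G}|\times|\mathcal{G}|$ block $\sum_g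 x(g)T^g$. $\mathbf{1}_k$ is the $k\times1$ all-ones vector. **BIBD.** For integers $v>k\geq 2$, a $\mathrm{BIBD}(v,k,1)$ is a $v$-element vertex set with a collection of $b$ subsets (blocks) such that every block contains exactly $k$ vertices and every pair of distinct vertices is in exactly one block. Its incidence matrix is $b\times v$ with rows indexed by blocks and columns by vertices. **ETF.** Vectors $\varphi_1,\dots,\varphi_n\in\mathbb{C}^m$ form an equiangular tight frame (ETF) for their span $H$ if they are nonzero with equal norms, there is $w$ with $|\langle\varphi_i,\varphi_j\rangle|=w$ for all $i\neq j$, and there is $a>0$ with $\sum_i\langle\varphi_i,x\rangle\varphi_i=ax$ for all $x\in H$ (inner product conjugate-linear in the first argument). ''$\Phi(\gamma)$ is a real ETF'' means the entries of $\Phi(\gamma)$ are real and its columns form an ETF for their span ($\gamma$ nontrivial). **Polyphase BIBD ETF.** Let $\mathcal{G}$ be an abelian group of order $f$. A polyphase matrix $\Phi(z)$ whose entries are monomials over $\mathcal{G}$ or zero is a $(v,k,f)$-polyphase BIBD ETF over $\mathcal{G}$ if $|\Phi(z)|^2$ is the incidence matrix of a $\mathrm{BIBD}(v,k,1)$ and, for all nontrivial characters $\gamma$ of $\mathcal{G}$, the columns of $\Phi(\gamma)$ form an ETF for their span. **Abelian DRACKN.** For positive integers $n,f,c$ with $f\geq 2$ and an abelian group $\mathcal{G}$ of order $f$, an abelian $(n,f,c)$-DRACKN is a self-adjoint $n\times n$ polyphase matrix $A(z)$ over $\mathcal{G}$ whose diagonal entries are zero, whose off-diagonal entries are monomials,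 and which satisfies $[A(z)]^2=(n-fc-2)A(z)+(n-1)I+c\,\mathbf{1}(z)(J-I)$, where $\mathbf{1}(z)=\sum_{g\in\mathcal{G}}z^g$ and $J$ is the all-ones matrix. **Generalized quadrangle.** For positive integers $s,t$, a $\mathrm{GQ}(s,t)$ is a set of vertices and a set of blocks (subsets of the vertex set) such that: every block contains exactly $s+1$ vertices; every vertex is in exactly $t+1$ blocks; two distinct blocks intersect in at most one vertex; two distinct vertices are contained in at most one block; and if vertex $i$ does not lie in block $j$, there is a unique pair $(i',j')$ such that vertex $i'$ is in blocks $j$ and $j'$ and block $j'$ contains both vertices $i$ and $i'$. Its incidence matrix has rows indexed by blocks and columns by vertices, with entry $1$ iff the vertex is in the block. *)

(* Defs.v *)
From HB Require Import structures.
From mathcomp Require Import all_boot all_order all_algebra.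
From mathcomp Require Import reals complex mxtens.

Set Implicit Arguments.
Unset Strict Implicit.
Unset Printing Implicit Defensive.

Import Order.TTheory GRing.Theory Num.Theory.
Local Open Scope ring_scope.

(* An alias of {ffun G -> C}, whose canonical product would be the pointwise
   one instead of the convolution. *)

Definition group_ring (C : comNzRingType) (G : finZmodType) := {ffun G -> C}.

Section GroupRing.
Variables (C : comNzRingType) (G : finZmodType).
Implicit Types x y : group_ring C G.

HB.instance Definition _ :=
  GRing.Zmodule.copy (group_ring C G) {ffun G -> C}.

Definition monomial (g : G) : group_ring C G := [ffun h => (h == g)%:R].

Definition gr_mul x y : group_ring C G :=
  [ffun g => \sum_h x h * y (g - h)].

Fact gr_mulC : commutative gr_mul.
Proof.
move=> x y; apply/ffunP=> g; rewrite !ffunE.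
rewrite (reindex_inj (can_inj (subKr g))) /=.
by apply: eq_bigr => h _; rewrite subKr mulrC.
Qed.

Fact gr_mulA : associative gr_mul.
Proof.
move=> x y z; apply/ffunP=> g; rewrite !ffunE.
under eq_bigr => h _ do rewrite ffunE mulr_sumr.
under [RHS]eq_bigr => h _ do rewrite ffunE mulr_suml.
rewrite [RHS]exchange_big /=; apply: eq_bigr => h _.
rewrite [RHS](reindex_inj (addrI h)) /=.
by apply: eq_bigr => k _; rewrite mulrA opprD addrA [h + k]addrC addrK.
Qed.

Fact gr_mul1 : left_id (monomial 0) gr_mul.
Proof.
move=> x; apply/ffunP=> g; rewrite !ffunE (bigD1 0) //= ffunE eqxx mul1r subr0.
by rewrite big1 ?addr0 // => h /negPf h0; rewrite ffunE h0 mul0r.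
Qed.

Fact gr_mulDl : left_distributive gr_mul +%R.
Proof.
move=> x y z; apply/ffunP=> g; rewrite !ffunE -big_split /=.
by apply: eq_bigr => h _; rewrite ffunE mulrDl.
Qed.

Fact gr_one_neq0 : monomial 0 != 0.
Proof.
by apply/eqP => /ffunP/(_ 0); rewrite !ffunE eqxx => /eqP; rewrite oner_eq0.
Qed.

HB.instance Definition _ := GRing.Zmodule_isComNzRing.Build (group_ring C G)
  gr_mulA gr_mulC gr_mul1 gr_mulDl gr_one_neq0.

Definition gr_all : group_ring C G := \sum_g monomial g.

End GroupRing.

Arguments monomial C {G} g.
Arguments gr_all C G : clear implicits.

Section Polyphase.
Variables (C : numClosedFieldType) (G : finZmodType).
Implicit Types (x : group_ring C G) (gamma : G -> C).

Definition gr_conj x : group_ring C G := [ffun g => (x (- g))^*].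

Definition pp_adjoint m n (Phi : 'M[group_ring C G]_(m, n)) :
  'M[group_ring C G]_(n, m) := (map_mx gr_conj Phi)^T.

Definition pp_abs2 m n (Phi : 'M[group_ring C G]_(m, n)) :
  'M[group_ring C G]_(m, n) := map_mx (fun x => gr_conj x * x) Phi.

Definition is_character gamma :=
  (forall g h, gamma (g + h) = gamma g * gamma h) /\
  (forall g, `|gamma g| = 1).

Definition nontrivial_character gamma :=
  is_character gamma /\ exists g, gamma g != 1.

Definition gr_eval gamma x : C := \sum_g x g * gamma g.

Definition pp_eval gamma m n (Phi : 'M[group_ring C G]_(m, n)) : 'M[C]_(m, n) :=
  map_mx (gr_eval gamma) Phi.

(* C^G is identified with C^#|G| through the enumeration enum_val of G. *)
Definition translation_mx (g : G) : 'M[C]_#|G| :=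
  \matrix_(i, j) (enum_val j == enum_val i - g)%:R.

Definition gr_mx x : 'M[C]_#|G| := \sum_g x g *: translation_mx g.

(* Block (i, j) of the result is gr_mx (Phi i j), with the same index
   convention as the Kronecker product *t of mxtens. *)
Definition pp_block_mx m n (Phi : 'M[group_ring C G]_(m, n)) :
  'M[C]_(m * #|G|, n * #|G|) :=
  \matrix_(i, j) gr_mx (Phi (mxtens_unindex i).1 (mxtens_unindex j).1)
                       (mxtens_unindex i).2 (mxtens_unindex j).2.

End Polyphase.

Definition abs2_mx (C : numClosedFieldType) m n (M : 'M[C]_(m, n)) :
  'M[C]_(m, n) := map_mx (fun x => `|x| ^+ 2) M.

(* A design with vertex set 'I_v and b blocks is a family 'I_b -> {set 'I_v}. *)

Definition incidence_mx (S : nzRingType) b v (B : 'I_b -> {set 'I_v}) :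
  'M[S]_(b, v) := \matrix_(i, j) (j \in B i)%:R.

Definition is_BIBD1 (v k b : nat) (B : 'I_b -> {set 'I_v}) :=
  [/\ (2 <= k < v)%N,
      injective B,
      forall i, #|B i| = k
    & forall x y, x != y -> exists! i, x \in B i /\ y \in B i].

Definition BIBD1_incidence (S : nzRingType) (v k b : nat) (M : 'M[S]_(b, v)) :=
  exists B : 'I_b -> {set 'I_v}, is_BIBD1 k B /\ M = incidence_mx S B.

Record is_GQ (s t v b : nat) (B : 'I_b -> {set 'I_v}) : Prop := IsGQ {
  GQ_s_gt0 : (0 < s)%N;
  GQ_t_gt0 : (0 < t)%N;
  GQ_inj : injective B;
  GQ_block : forall j, #|B j| = s.+1;
  GQ_vertex : forall i, #|[set j | i \in B j]| = t.+1;
  GQ_blocks2 : forall j j', j != j' -> (#|B j :&: B j'| <= 1)%N;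
  GQ_vertices2 : forall i i', i != i' ->
    (#|[set j | (i \in B j) && (i' \in B j)]| <= 1)%N;
  GQ_axiom : forall i j, i \notin B j ->
    exists! p : 'I_v * 'I_b,
      [/\ p.1 \in B j, p.1 \in B p.2 & i \in B p.2]
}.

Definition GQ_incidence (S : nzRingType) (s t b v : nat) (M : 'M[S]_(b, v)) :=
  exists B : 'I_b -> {set 'I_v}, is_GQ s t B /\ M = incidence_mx S B.

Section ETF.
Variable C : numClosedFieldType.

Definition hdot m (u w : 'cV[C]_m) : C := \sum_i (u i 0)^* * w i 0.

Definition hnorm m (u : 'cV[C]_m) : C := sqrtC (hdot u u).

(* The span of the columns of M is the row space of M^T. *)
Definition is_ETF m n (M : 'M[C]_(m, n)) :=
  [/\ forall i, col i M != 0,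
      forall i j, hnorm (col i M) = hnorm (col j M),
      exists w : C, forall i j, i != j -> `|hdot (col i M) (col j M)| = w
    & exists2 a : C, 0 < a &
      forall x : 'cV[C]_m, (x^T <= M^T)%MS ->
        \sum_i hdot (col i M) x *: col i M = a *: x].

Definition real_mx m n (M : 'M[C]_(m, n)) := forall i j, M i j \is Num.real.

End ETF.

Definition polyphase_BIBD_ETF (C : numClosedFieldType) (G : finZmodType)
    (v k f b : nat) (Phi : 'M[group_ring C G]_(b, v)) :=
  [/\ #|G| = f,
      forall i j, Phi i j = 0 \/ exists g, Phi i j = monomial C g,
      BIBD1_incidence k (pp_abs2 Phi)
    & forall gamma : G -> C, nontrivial_character gamma ->
      is_ETF (pp_eval gamma Phi)].

Definition abelian_DRACKN (C : numClosedFieldType) (G : finZmodType)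
    (n f c : nat) (A : 'M[group_ring C G]_n) :=
  [/\ [/\ (0 < n)%N, (2 <= f)%N, (0 < c)%N & #|G| = f],
      pp_adjoint A = A,
      forall i, A i i = 0,
      forall i j, i != j -> exists g, A i j = monomial C g
    & A *m A = (n%:Z - f%:Z * c%:Z - 2)%:~R *: A + (n%:R - 1)%:M
               + (c%:R * gr_all C G) *: (const_mx 1 - 1%:M)].

Definition abelian_GQ_mx (C : numClosedFieldType) (G : finZmodType) (b v : nat)
    (Phi : 'M[group_ring C G]_(b, v)) :
  'M[C]_(v * 1 + b * #|G|, v * #|G|) :=
  col_mx ((1%:M : 'M[C]_v) *t (const_mx 1 : 'rV[C]_#|G|)) (pp_block_mx Phi).

Definition prime_power (q : nat) :=
  exists p e : nat, [/\ prime p, (0 < e)%N & q = (p ^ e)%N].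

(* Main.v *)
(* The vertices of the quadrangle are the points of the elliptic quadric
   Q^-(5,q), realized on K^3, where K is the field of order q^2, by the quadratic
   form x |-> <x,x> over F_q attached to a Hermitian form.  The group
   K^*/F_q^* = Z_(q+1) acts by scalars, and its orbits are the q^3+1 isotropic
   points p_i of the Hermitian unital.  For i != j exactly one
   class d_ij of scalars makes p_i and d_ij p_j perpendicular for the trace form,
   and d_ij + d_jk = d_ik holds iff p_i, p_j, p_k are on a line.  Choosing a base
   point o_l on each line l of the unital, Phi(l, j) = z^(d_(o_l, j)).  If i is
   not on l, then j |-> d_ij - d_(o_l, j) is injective, hence bijective, from l
   to Z_(q+1): this is both the quadrangle axiom and, after summation of a
   nontrivial character, the identity Phi Phi^* Phi = (q^2 + q) Phi.

   Conversely, this tightness identity holds at every nontrivial character of any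
   polyphase BIBD ETF, its constant being forced by the diagonal of the squared
   Gram matrix.  The rank is then read off a trace, and the DRACKN identity holds
   at every character, hence in the group ring. *)

From HB Require Import structures.
Require Import Defs.
From mathcomp Require Import all_boot all_order all_algebra.
From mathcomp Require Import all_solvable all_field.
From mathcomp Require Import reals complex mxtens ring.

Set Implicit Arguments.
Unset Strict Implicit.
Unset Printing Implicit Defensive.

Import Order.TTheory GRing.Theory Num.Theory.
Local Open Scope ring_scope.

(** * Group rings and characters *)

Section GroupRingEval.
Variables (C : numClosedFieldType) (G : finZmodType).
Implicit Types (x y : group_ring C G) (gamma : G -> C).

Lemma monomialD (g h : G) :
  monomial C (g + h) = monomial C g * monomial C h.
Proof.
apply/ffunP=> k; rewrite !ffunE (bigD1 g) //= big1 => [|l /negPf lg].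
  by rewrite !ffunE eqxx mul1r addr0 subr_eq addrC.
by rewrite ffunE lg mul0r.
Qed.

Lemma gr_conj_monomial (g : G) : gr_conj (monomial C g) = monomial C (- g).
Proof. by apply/ffunP=> h; rewrite !ffunE conjC_nat eqr_oppLR. Qed.

Lemma gr_conj0 : gr_conj (0 : group_ring C G) = 0.
Proof. by apply/ffunP=> h; rewrite !ffunE conjC0. Qed.

Lemma monomial_neq0 (g : G) : monomial C g != 0.
Proof.
by apply/eqP=> /ffunP/(_ g); rewrite !ffunE eqxx => /eqP; rewrite oner_eq0.
Qed.

Lemma gr_eval_monomial gamma (g : G) : gr_eval gamma (monomial C g) = gamma g.
Proof.
rewrite /gr_eval (bigD1 g) //= big1 => [|h /negPf hg]; rewrite ffunE.
  by rewrite eqxx mul1r addr0.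
by rewrite hg mul0r.
Qed.

Lemma gr_eval0 gamma : gr_eval gamma (0 : group_ring C G) = 0.
Proof. by rewrite /gr_eval big1 // => g _; rewrite ffunE mul0r. Qed.

Lemma gr_evalB gamma : zmod_morphism (gr_eval gamma).
Proof.
move=> x y; rewrite /gr_eval -sumrB; apply: eq_bigr => g _.
by rewrite !ffunE mulrBl.
Qed.

Lemma character0 gamma : is_character gamma -> gamma 0 = 1.
Proof.
case=> gammaD gamma1; apply/(mulfI (x := gamma 0)).
  by rewrite -normr_eq0 gamma1 oner_eq0.
by rewrite -gammaD addr0 mulr1.
Qed.

Lemma characterN gamma g : is_character gamma -> gamma (- g) = (gamma g)^*.
Proof.
move=> chi; have [gammaD gamma1] := chi.
rewrite -(mulr1 (gamma (- g))) -(expr1n _ 2) -(gamma1 g) normCK mulrA.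
by rewrite -gammaD addNr character0 // mul1r.
Qed.

Lemma gr_eval_monoid gamma : is_character gamma ->
  monoid_morphism (gr_eval gamma).
Proof.
move=> chi; have [gammaD _] := chi; split.
  by rewrite [1]/(monomial C 0) gr_eval_monomial character0.
move=> x y; rewrite /gr_eval big_distrlr /=.
under eq_bigr => g _ do rewrite ffunE mulr_suml.
rewrite exchange_big /=; apply: eq_bigr => h _.
rewrite (reindex_inj (addrI h)) /=; apply: eq_bigr => k _.
by rewrite [h + k - h]addrC addKr gammaD mulrACA.
Qed.

(** Evaluation is a ring morphism only under the hypothesis that [gamma] is a character, so the
    bundled morphism is delivered existentially; rewriting with it opens the [map_mx] and [rmorph]
    lemmas. *)
Lemma gr_eval_rmorphism gamma : is_character gamma ->
  exists f : {rmorphism group_ring C G -> C}, gr_eval gamma = f.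
Proof.
move=> chi.
pose mA := GRing.isZmodMorphism.Build _ _ (gr_eval gamma) (gr_evalB gamma).
pose mM :=
  GRing.isMonoidMorphism.Build _ _ (gr_eval gamma) (gr_eval_monoid chi).
pose f : {rmorphism group_ring C G -> C} := HB.pack (gr_eval gamma) mA mM.
by exists f.
Qed.

Lemma gr_eval_conj gamma x : is_character gamma ->
  gr_eval gamma (gr_conj x) = (gr_eval gamma x)^*.
Proof.
move=> chi; rewrite /gr_eval rmorph_sum (reindex_inj oppr_inj) /=.
by apply: eq_bigr => g _; rewrite ffunE opprK rmorphM /= characterN.
Qed.

Lemma gr_eval_all gamma : gr_eval gamma (gr_all C G) = \sum_g gamma g.
Proof.
rewrite /gr_eval; apply: eq_bigr => g _; rewrite /gr_all sum_ffunE.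
rewrite (bigD1 g) //= big1 => [|h /negPf hg]; rewrite ffunE.
  by rewrite eqxx addr0 mul1r.
by rewrite eq_sym hg.
Qed.

Lemma sum_nontrivial_character gamma :
  nontrivial_character gamma -> \sum_g gamma g = 0.
Proof.
case=> [[gammaD _]] [h h1].
have/eqP: gamma h * (\sum_g gamma g) = \sum_g gamma g.
  rewrite [RHS](reindex_inj (addrI h)) mulr_sumr /=.
  by apply: eq_bigr => g _; rewrite gammaD.
rewrite -subr_eq0 -{2}[\sum_g gamma g]mul1r -mulrBl mulf_eq0 subr_eq0.
by rewrite (negPf h1) => /eqP.
Qed.

Lemma character_nontrivialP gamma : is_character gamma ->
  (forall g, gamma g = 1) \/ nontrivial_character gamma.
Proof.
move=> chi; case: (boolP [forall g, gamma g == 1]) => [/forallP g1|].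
  by left=> g; apply/eqP.
by rewrite negb_forall => /existsP[g g1]; right; split=> //; exists g.
Qed.

End GroupRingEval.

(** * Characters of a cyclic group separate the group ring *)

Section CyclicCharacters.
Variables (C : numClosedFieldType) (n : nat).
Hypothesis n_gt1 : (1 < n)%N.

Lemma prim_root_exists : exists z : C, n.-primitive_root z.
Proof.
have n_gt0 := ltnW n_gt1.
have [rs Drs] := closed_field_poly_normal ('X^n - 1 : {poly C}).
rewrite (monicP (monicXnsubC _ n_gt0)) scale1r in Drs.
have urs : all n.-unity_root rs.
  by apply/allP=> z; rewrite -root_prod_XsubC -Drs.
have uniq_rs : uniq rs.
  by rewrite -separable_prod_XsubC -Drs separable_Xn_sub_1 // pnatr_eq0 -lt0n.
have szrs : (n <= size rs)%N.
  by rewrite -ltnS -(size_prod_XsubC rs id) -Drs size_XnsubC.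
by have/hasP[z _ pz] := has_prim_root n_gt0 urs uniq_rs szrs; exists z.
Qed.

Lemma Zp_expr_character (z : C) : z ^+ n = 1 ->
  is_character (fun g : 'Z_n => z ^+ g).
Proof.
move=> zn; split=> [g h|g].
  have -> : ((g + h)%R : nat) = ((g + h) %% n)%N.
    by congr (_ %% _)%N; apply: Zp_cast.
  by rewrite expr_mod // exprD.
rewrite normrX; have/(congr1 Num.norm)/eqP := zn.
by rewrite normrX normr1 pexpr_eq1 ?(ltnW n_gt1) // => /eqP->; rewrite expr1n.
Qed.

(** The coefficients of x - y form a polynomial of degree below n that vanishes at the n distinct
    powers of a primitive n-th root of unity, hence is zero. Group-ring identities can thus be
    checked one character at a time. *)
Lemma group_ring_ext (x y : group_ring C 'Z_n) :
  (forall gamma, is_character gamma -> gr_eval gamma x = gr_eval gamma y) ->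
  x = y.
Proof.
move=> eqxy; have [z pz] := prim_root_exists.
have [n_gt0 zn] := (ltnW n_gt1, prim_expr_order pz).
pose c := x - y; pose p := \poly_(i < n) c (inord i : 'Z_n).
suff p0 : p = 0.
  apply/eqP; rewrite -subr_eq0; apply/eqP/ffunP=> g.
  have gn : (g < n)%N by have := ltn_ord g; rewrite [X in (_ < X)%N]Zp_cast.
  have := congr1 (fun r : {poly C} => r`_g) p0.
  by rewrite coef_poly gn inord_val coef0 => cg; rewrite -/c cg ffunE.
apply: (@roots_geq_poly_eq0 _ _ [seq z ^+ i | i <- iota 0 n]).
- apply/allP=> w /mapP[i _ Dw]; rewrite Dw rootE horner_poly.
  have chi : is_character (fun g : 'Z_n => (z ^+ i) ^+ g).
    by apply: Zp_expr_character; rewrite exprAC zn expr1n.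
  have := eqxy _ chi => /eqP; rewrite -subr_eq0 -gr_evalB -/c => /eqP {2}<-.
  rewrite /gr_eval; apply/eqP.
  (* The bound of the ordinal type ['Z_n] equals n only through [Zp_cast]; both sums are therefore
     turned into sums over natural numbers. *)
  rewrite [RHS](eq_bigr (fun g : 'Z_n => (c (inord g)) * (z ^+ i) ^+ g)).
    rewrite -(big_mkord xpredT (fun k => c (inord k) * (z ^+ i) ^+ k)).
    rewrite -(big_mkord xpredT (fun k => c (inord k) * (z ^+ i) ^+ k)).
    by rewrite Zp_cast.
  by move=> g _; rewrite inord_val.
- rewrite map_inj_in_uniq ?iota_uniq // => i j; rewrite !mem_iota /= => ilt jlt.
  by move/eqP; rewrite (eq_prim_root_expr pz) !modn_small // => /eqP.
- by rewrite size_map size_iota size_poly.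
Qed.

End CyclicCharacters.

(** * Tight frames and phased designs *)

Section TightFrames.
Variable C : numClosedFieldType.

Definition adjmx m n (M : 'M[C]_(m, n)) : 'M[C]_(n, m) := (map_mx Num.conj M)^T.

Lemma adjmxE m n (M : 'M[C]_(m, n)) i j : adjmx M i j = (M j i)^*.
Proof. by rewrite !mxE. Qed.

Variables (m n : nat) (M : 'M[C]_(m, n)).

Lemma hdot_col (x : 'cV[C]_m) i : hdot (col i M) x = (adjmx M *m x) i 0.
Proof. by rewrite /hdot mxE; apply: eq_bigr => j _; rewrite adjmxE mxE. Qed.

Lemma gramE i j : hdot (col i M) (col j M) = (adjmx M *m M) i j.
Proof.
by rewrite hdot_col !mxE; apply: eq_bigr => k _; rewrite [col _ _ _ _]mxE.
Qed.

Lemma gram_conj i j : (adjmx M *m M) j i = ((adjmx M *m M) i j)^*.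
Proof.
rewrite !mxE rmorph_sum; apply: eq_bigr => k _.
by rewrite !adjmxE rmorphM /= conjCK mulrC.
Qed.

Lemma frame_operatorE (x : 'cV[C]_m) :
  \sum_i hdot (col i M) x *: col i M = M *m (adjmx M *m x).
Proof.
apply/colP=> k; rewrite summxE [RHS]mxE; apply: eq_bigr => i _.
by rewrite hdot_col [LHS]mxE mulrC; congr (_ * _); rewrite mxE.
Qed.

(** Each column lies in the span, so the frame identity applied to all columns at once is M M^* M =
    a M. *)
Lemma ETF_tight : is_ETF M ->
  exists2 a : C, 0 < a & M *m (adjmx M *m M) = a *: M.
Proof.
case=> _ _ _ [a a_gt0 frM]; exists a => //; apply/matrixP=> k i.
have := frM (col i M); rewrite frame_operatorE tr_col row_sub => /(_ isT).
move/colP/(_ k); rewrite !mxE => <-; apply: eq_bigr => j _.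
by rewrite -hdot_col gramE.
Qed.

(** Every vector of the span is M y for some y, so M M^* M = a M already gives tightness on the
    whole span. *)
Lemma ETF_intro (r a : C) : 0 < r -> 0 < a ->
    (forall i, (adjmx M *m M) i i = r) ->
    (forall i j, i != j -> `|(adjmx M *m M) i j| = 1) ->
    M *m (adjmx M *m M) = a *: M ->
  is_ETF M.
Proof.
move=> r_gt0 a_gt0 diag off tight; split.
- move=> i; apply: contraTneq r_gt0 => ci0.
  rewrite -(diag i) -gramE ci0 /hdot big1 ?ltxx // => k _.
  by rewrite !mxE mulr0.
- by move=> i j; rewrite /hnorm !gramE !diag.
- by exists 1 => i j ij; rewrite gramE off.
exists a => // x /submxP[y Dx].
have {Dx} -> : x = M *m y^T by rewrite -[x]trmxK Dx trmx_mul trmxK.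
by rewrite frame_operatorE !mulmxA -(mulmxA M) tight scalemxAl.
Qed.

(** The matrix P = M^* M / a is idempotent with the row space of M, and the trace of an idempotent
    is its rank. *)
Lemma rank_tight (a : C) : 0 < a -> M *m (adjmx M *m M) = a *: M ->
  a * (\rank M)%:R = \tr (adjmx M *m M).
Proof.
move=> a_gt0 tight; set H := adjmx M *m M; have a0 := lt0r_neq0 a_gt0.
pose P := a^-1 *: H.
have MP : M *m P = M by rewrite -scalemxAr tight scalerA mulVf ?scale1r.
have PP : P *m P = P by rewrite /P -scalemxAl -/P -mulmxA MP.
have rP : \rank P = \rank M.
  apply/eqP; rewrite eqn_leq (mxrankS (A := M)) ?andbT; last first.
    by rewrite -{1}MP submxMl.
  by rewrite mxrankS // /P scalemxAl submxMl.
(* In P P = P, with P factored through its rank, the outer full-rank factors cancel; then tr P is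
   the trace of this identity matrix. *)
have id1 : row_base P *m col_base P = 1%:M.
  apply: (row_free_inj (row_base_free P)).
  apply: (row_full_inj (col_base_full P)).
  rewrite mul1mx -(mulmxA (row_base P)) mulmx_base.
  by rewrite (mulmxA (col_base P) (row_base P)) mulmx_base PP.
have -> : \tr H = a * \tr P by rewrite mxtraceZ mulrA mulfV ?mul1r.
by rewrite -[in \tr P](mulmx_base P) mxtrace_mulC id1 mxtrace1 rP.
Qed.

End TightFrames.

(** * Replication number of a design *)

Section Designs.
Variables (v k b : nat) (B : 'I_b -> {set 'I_v}).
Hypothesis BB : is_BIBD1 k B.

(** Double counting of the pairs (l, y) with x and y on l and y != x: each y occurs with exactly one
    l. *)
Lemma BIBD1_replication x : (#|[set l | x \in B l]| * k.-1 = v.-1)%N.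
Proof.
have [_ _ cardB uniqB] := BB.
have cardB1 l : x \in B l -> (\sum_(y in B l | y != x) 1 = k.-1)%N.
  move=> xl; rewrite -(cardB l) (cardsD1 x) xl add1n sum1_card /=.
  by apply: eq_card => y; rewrite !inE andbC.
transitivity (\sum_(l | x \in B l) \sum_(y in B l | y != x) 1)%N.
  rewrite (eq_bigr _ cardB1) sum_nat_const; congr (_ * _)%N.
  by apply: eq_card => l; rewrite inE.
rewrite (exchange_big_dep (fun y => y != x)) /=; last by move=> l y _ /andP[].
transitivity (\sum_(y | y != x) 1)%N; last first.
  by rewrite sum1_card -[v in RHS]card_ord (cardC1 x).
apply: eq_bigr => y yx; have [l [[xl yl] lP]] := uniqB _ _ yx.
rewrite (bigD1 l) /= ?xl ?yl // big1 ?addn0 // => l'.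
move=> /andP[/andP[xl' /andP[yl' _]]].
by rewrite (lP l') ?eqxx.
Qed.

End Designs.

(** * Polyphase matrices as a design together with phases *)

Section PhaseMatrix.
Variables (C : numClosedFieldType) (G : finZmodType) (v b : nat).
Variables (B : 'I_b -> {set 'I_v}).

Definition phase_mx (s : 'I_b -> 'I_v -> G) : 'M[group_ring C G]_(b, v) :=
  \matrix_(l, i) if i \in B l then monomial C (s l i) else 0.

Lemma phase_mxP (Phi : 'M[group_ring C G]_(b, v)) :
    (forall l i, Phi l i = 0 \/ exists g, Phi l i = monomial C g) ->
    pp_abs2 Phi = incidence_mx (group_ring C G) B ->
  exists s, Phi = phase_mx s.
Proof.
move=> monPhi absPhi.
(* The default phase is taken only at zero entries of [Phi], which lie outside the blocks: a
   monomial has squared modulus 1. *)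
exists (fun l i => odflt 0 [pick g | Phi l i == monomial C g]).
apply/matrixP=> l i; rewrite mxE; move/matrixP/(_ l i): absPhi; rewrite !mxE.
case: pickP => [g /eqP-> | noPhi] /=.
  case: (i \in B l) => //; rewrite gr_conj_monomial -monomialD addNr.
  by move/eqP; rewrite (negPf (monomial_neq0 _ _)).
case: (monPhi l i) => [-> | [g Dg]]; last by have := noPhi g; rewrite Dg eqxx.
by case: (i \in B l) => //; rewrite mulr0 => /esym/eqP; rewrite oner_eq0.
Qed.

Variable s : 'I_b -> 'I_v -> G.

Lemma pp_abs2_phase_mx :
  pp_abs2 (phase_mx s) = incidence_mx (group_ring C G) B.
Proof.
apply/matrixP=> l i; rewrite !mxE; case: (i \in B l); last by rewrite mulr0.
by rewrite gr_conj_monomial -monomialD addNr.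
Qed.

Lemma pp_eval_phase_mx gamma l i :
  pp_eval gamma (phase_mx s) l i = (i \in B l)%:R * gamma (s l i).
Proof.
rewrite !mxE; case: (i \in B l); rewrite ?gr_eval0 ?mul0r //.
by rewrite mul1r gr_eval_monomial.
Qed.

Lemma phase_gramE i j :
  (pp_adjoint (phase_mx s) *m phase_mx s) i j =
  \sum_(l | (i \in B l) && (j \in B l)) monomial C (s l j - s l i).
Proof.
rewrite mxE [RHS]big_mkcond; apply: eq_bigr => l _; rewrite !mxE.
case: (i \in B l); last by rewrite gr_conj0 mul0r.
case: (j \in B l); last by rewrite mulr0.
by rewrite gr_conj_monomial -monomialD addrC.
Qed.

Lemma phase_gram_diag i :
  (pp_adjoint (phase_mx s) *m phase_mx s) i i = #|[set l | i \in B l]|%:R.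
Proof.
rewrite phase_gramE (eq_bigr (fun=> 1)) => [|l _]; last by rewrite subrr.
rewrite sumr_const; congr (_ *+ _); apply: eq_card => l.
by rewrite inE /in_mem /= andbb.
Qed.

Lemma phase_gram_off k i j : is_BIBD1 k B -> i != j ->
  exists l, [/\ i \in B l, j \in B l &
    (pp_adjoint (phase_mx s) *m phase_mx s) i j = monomial C (s l j - s l i)].
Proof.
case=> _ _ _ uniqB ij; have [l [[il jl] lP]] := uniqB _ _ ij.
exists l; split=> //; rewrite phase_gramE (bigD1 l) ?il //= big1 ?addr0 //.
by move=> l' /andP[/andP[il' jl']]; rewrite (lP l') ?eqxx.
Qed.

End PhaseMatrix.

Lemma pp_eval_gram (C : numClosedFieldType) (G : finZmodType) gamma v b
    (Phi : 'M[group_ring C G]_(b, v)) : is_character gamma ->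
  pp_eval gamma (pp_adjoint Phi *m Phi) =
  adjmx (pp_eval gamma Phi) *m pp_eval gamma Phi.
Proof.
move=> chi; have [f Df] := gr_eval_rmorphism chi.
have -> : adjmx (pp_eval gamma Phi) = pp_eval gamma (pp_adjoint Phi).
  by apply/matrixP=> i j; rewrite !mxE gr_eval_conj.
by rewrite /pp_eval Df map_mxM.
Qed.

Section TightConstant.
Variables (C : numClosedFieldType) (m n : nat) (M : 'M[C]_(m, n.+1)) (r a : C).
Hypothesis r_gt0 : 0 < r.
Hypothesis diag : forall i, (adjmx M *m M) i i = r.
Hypothesis off : forall i j, i != j -> `|(adjmx M *m M) i j| = 1.
Hypothesis tight : M *m (adjmx M *m M) = a *: M.

(** With H the Gram matrix, this is the (0,0) entry of H^2 = a H: the diagonal entry contributes r^2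
    and each of the n others has modulus 1. *)
Lemma tight_constant : a * r = r ^+ 2 + n%:R.
Proof.
have := congr1 (fun N => (adjmx M *m N) 0 0) tight.
rewrite /= -scalemxAr mulmxA mxE [in RHS]mxE diag => <-.
rewrite (bigD1 0) //= diag -expr2; congr (_ + _).
rewrite (eq_bigr (fun=> 1)) => [|j j0]; last first.
  by rewrite gram_conj mulrC -normCK off // expr1n.
by rewrite sumr_const (cardC1 (0 : 'I_n.+1)) card_ord.
Qed.

End TightConstant.

(** The right-hand side of the DRACKN equation, evaluated entrywise with J - I written as 1 - (i ==
    j), so that [ring] can finish in C. *)
Lemma gr_eval_srg (C : numClosedFieldType) (G : finZmodType) (gamma : G -> C)
    n (N : 'M[group_ring C G]_n) (k c : int) (d : nat) (x : group_ring C G) i j :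
    is_character gamma ->
  gr_eval gamma ((k%:~R *: N + (c%:~R)%:M +
                  (d%:R * x) *: (const_mx 1 - 1%:M)) i j) =
  k%:~R * gr_eval gamma (N i j) + c%:~R * (i == j)%:R +
  d%:R * gr_eval gamma x * (1 - (i == j)%:R).
Proof.
move=> chi; have [f ->] := gr_eval_rmorphism chi.
rewrite !mxE !rmorphD !rmorphM /= rmorphB rmorphMn !rmorph_int !rmorph_nat.
by rewrite rmorph1 mulr_natr.
Qed.

(** * Rank and DRACKN of a polyphase BIBD ETF with q^3+1 columns *)

Section PolyphaseETF.
Variables (C : numClosedFieldType) (q b : nat).
Hypothesis q_gt1 : (1 < q)%N.
Variable B : 'I_b -> {set 'I_(q ^ 3).+1}.
Hypothesis BB : is_BIBD1 q.+1 B.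
Variable s : 'I_b -> 'I_(q ^ 3).+1 -> 'Z_q.+1.
Let Phi := phase_mx C B s.

Let n_gt1 : (1 < q.+1)%N. Proof. exact: ltnW. Qed.

Let q2_gt0 : 0 < (q ^ 2)%:R :> C.
Proof. by rewrite ltr0n expn_gt0 ltnW. Qed.

Lemma unital_replication i : #|[set l | i \in B l]| = (q ^ 2)%N.
Proof.
have := BIBD1_replication BB i; rewrite /= [RHS]expnSr => /eqP.
by rewrite eqn_pmul2r ?(ltnW q_gt1) // => /eqP.
Qed.

Section Evaluation.
Variable gamma : 'Z_q.+1 -> C.
Hypothesis chi : is_character gamma.
Let M := pp_eval gamma Phi.

Lemma eval_gram_diag i : (adjmx M *m M) i i = (q ^ 2)%:R.
Proof.
have [f Df] := gr_eval_rmorphism chi.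
rewrite -pp_eval_gram // mxE phase_gram_diag unital_replication.
by rewrite Df rmorph_nat.
Qed.

Lemma eval_gram_off i j : i != j -> `|(adjmx M *m M) i j| = 1.
Proof.
move=> ij; rewrite -pp_eval_gram // mxE.
have [l [_ _ ->]] := phase_gram_off C s BB ij.
by rewrite gr_eval_monomial; case: chi.
Qed.

Lemma eval_abs2 : abs2_mx M = incidence_mx C B.
Proof.
apply/matrixP=> l i; rewrite mxE pp_eval_phase_mx mxE.
by case: chi => _ g1; rewrite normrM g1 mulr1 normr_nat -natrX; case: (i \in _).
Qed.

(** The diagonal of the Gram matrix is q^2 and there are q^3 other columns, so [tight_constant]
    reads a q^2 = q^4 + q^3. *)
Lemma eval_tight : is_ETF M ->
  M *m (adjmx M *m M) = (q ^ 2 + q)%:R *: M.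
Proof.
case/ETF_tight=> a a_gt0 tight; rewrite tight; congr (_ *: _).
apply: (mulIf (lt0r_neq0 q2_gt0)).
rewrite (tight_constant eval_gram_diag eval_gram_off tight).
by rewrite -natrX -natrD -natrM; congr _%:R; ring.
Qed.


(** By [rank_tight], (q^2 + q) rank M = (q^3 + 1) q^2, and q^3 + 1 = (q + 1)(q^2 - q + 1). *)
Lemma eval_rank : is_ETF M -> \rank M = (q * (q ^ 2 - q + 1))%N.
Proof.
move=> etf; have a_gt0 : 0 < (q ^ 2 + q)%:R :> C.
  by rewrite ltr0n addn_gt0 expn_gt0 (ltnW q_gt1).
have := rank_tight a_gt0 (eval_tight etf).
rewrite /mxtrace (eq_bigr _ (fun i _ => eval_gram_diag i)).
rewrite sumr_const card_ord -[RHS]mulr_natr -!natrM => /eqP.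
rewrite eqr_nat => /eqP rkM; have {rkM} /eqP :
    ((q ^ 2 + q) * \rank M = (q ^ 2 + q) * (q * (q ^ 2 - q + 1)))%N.
  (* Writing q = e + 1 removes the truncated subtraction, since q^2 - q = (e + 1) e. *)
  rewrite rkM; case: (q) => // e.
  have -> : (e.+1 ^ 2 - e.+1 = e.+1 * e)%N.
    by rewrite -{2}[e.+1]muln1 -mulnBr subn1.
  ring.
by rewrite eqn_pmul2l ?addn_gt0 ?expn_gt0 ?(ltnW q_gt1) // => /eqP.
Qed.

End Evaluation.

Let A := pp_adjoint Phi *m Phi - ((q ^ 2)%:R)%:M.

Let AE i j : A i j =
  (pp_adjoint Phi *m Phi) i j - (q ^ 2)%:R *+ (i == j).
Proof. by rewrite [LHS]mxE; congr (_ + _); rewrite !mxE. Qed.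

(** Self-adjointness and the quadratic identity are checked at each character. With H the evaluated
    Gram matrix, a nontrivial character gives H^2 = (q^2 + q) H by tightness, while the trivial one
    gives H = J + (q^2 - 1) I by the design property alone. *)
Lemma phase_DRACKN :
  (forall gamma : 'Z_q.+1 -> C, nontrivial_character gamma ->
    is_ETF (pp_eval gamma Phi)) ->
  abelian_DRACKN q.+1 (q ^ 2 - 1) A.
Proof.
move=> etf; have q2_gt1 : (1 < q ^ 2)%N by rewrite (ltn_exp2l 0).
have evalA gamma : is_character gamma ->
    pp_eval gamma A = adjmx (pp_eval gamma Phi) *m pp_eval gamma Phi
                      - ((q ^ 2)%:R)%:M.
  move=> chi; have [f Df] := gr_eval_rmorphism chi.
  rewrite -pp_eval_gram // /pp_eval Df /A map_mxB; congr (_ - _).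
  by rewrite map_scalar_mx /= rmorph_nat.
split.
- by split=> //; rewrite ?subn_gt0 // card_ord Zp_cast.
- apply/matrixP=> i j; apply: (group_ring_ext n_gt1) => gamma chi.
  have -> : gr_eval gamma (pp_adjoint A i j) = (gr_eval gamma (A j i))^*.
    by rewrite [pp_adjoint A i j]mxE [map_mx _ _ _ _]mxE gr_eval_conj.
  have EA k l : gr_eval gamma (A k l) =
      (adjmx (pp_eval gamma Phi) *m pp_eval gamma Phi) k l -
      (q ^ 2)%:R *+ (k == l).
    transitivity (pp_eval gamma A k l); first by rewrite [RHS]mxE.
    by rewrite evalA // [LHS]mxE; congr (_ + _); rewrite !mxE.
  by rewrite !EA rmorphB /= -gram_conj rmorphMn /= conjC_nat eq_sym.
- by move=> i; rewrite AE phase_gram_diag unital_replication eqxx subrr.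
- move=> i j ij; have [l [_ _ gij]] := phase_gram_off C s BB ij.
  by exists (s l j - s l i); rewrite AE gij (negPf ij) subr0.
apply/matrixP=> i j; apply: (group_ring_ext n_gt1) => gamma chi.
have -> : ((q ^ 3).+1%:R - 1 : group_ring C 'Z_q.+1) = ((q ^ 3)%:Z)%:~R.
  by rewrite -natr1 addrK.
rewrite gr_eval_srg // AE.
pose H := adjmx (pp_eval gamma Phi) *m pp_eval gamma Phi.
have [f Df] := gr_eval_rmorphism chi.
have evalG k l : gr_eval gamma ((pp_adjoint Phi *m Phi) k l) = H k l.
  by rewrite /H -pp_eval_gram // [RHS]mxE.
have -> : gr_eval gamma ((A *m A) i j) =
    (H *m H) i j - 2 * q%:R ^+ 2 * H i j + q%:R ^+ 4 * (i == j)%:R.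
  transitivity (pp_eval gamma (A *m A) i j); first by rewrite [RHS]mxE.
  rewrite /pp_eval Df map_mxM -Df -/(pp_eval gamma A) evalA // -/H.
  rewrite mulmxBr !mulmxBl mul_mx_scalar mul_scalar_mx -scalar_mxM.
  move: (H *m H) => w; rewrite !mxE -mulr_natr natrX; ring.
have -> : gr_eval gamma ((pp_adjoint Phi *m Phi) i j - (q ^ 2)%:R *+ (i == j))
          = H i j - q%:R ^+ 2 * (i == j)%:R.
  rewrite (gr_evalB gamma) evalG Df rmorphMn rmorph_nat natrX /=.
  by rewrite mulr_natr.
(* This is n - f c - 2 for n = q^3 + 1, f = q + 1, c = q^2 - 1. *)
have -> : (((q ^ 3).+1%:Z - q.+1%:Z * (q ^ 2 - 1)%:Z - 2)%:~R : C) =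
          q%:R - q%:R ^+ 2.
  have PX k : (q ^ k)%N%:Z = q%:Z ^+ k by rewrite -!natz natrX.
  have -> : (q ^ 3).+1%:Z - q.+1%:Z * (q ^ 2 - 1)%:Z - 2 = q%:Z - q%:Z ^+ 2.
    rewrite -[(q ^ 2 - 1)%:Z]subzn ?expn_gt0 ?(ltnW q_gt1) //.
    rewrite -addn1 -(addn1 q) !PoszD !PX; ring.
  by rewrite rmorphB rmorphXn.
have -> : ((q ^ 2 - 1)%:R : C) = q%:R ^+ 2 - 1.
  by rewrite natrB ?expn_gt0 ?(ltnW q_gt1) // natrX.
rewrite -pmulrn natrX.
have [triv | nontriv] := character_nontrivialP chi; last first.
  rewrite gr_eval_all sum_nontrivial_character // mulr0 mul0r addr0.
  have -> : (H *m H) i j = (q%:R ^+ 2 + q%:R) * H i j.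
    rewrite /H -mulmxA eval_tight //; last exact: etf.
    by rewrite -scalemxAr mxE natrD natrX.
  ring.
(* The trivial character remains; here the all-ones element evaluates to the group order instead of
   vanishing. *)
have -> : gr_eval gamma (gr_all C 'Z_q.+1) = q%:R + 1.
  rewrite gr_eval_all (eq_bigr (fun=> 1)) // sumr_const card_ord Zp_cast //.
  by rewrite natr1.
have EH k l : H k l = 1 + (q%:R ^+ 2 - 1) * (k == l)%:R.
  have [<- | kl] := eqVneq k l.
    by rewrite /H eval_gram_diag // natrX mulr1 addrC subrK.
  have [m [_ _ gkl]] := phase_gram_off C s BB kl.
  by rewrite -evalG gkl gr_eval_monomial triv mulr0 addr0.
have -> : (H *m H) i j = (q%:R ^+ 3 + 1) + 2 * (q%:R ^+ 2 - 1) +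
                         (q%:R ^+ 2 - 1) ^+ 2 * (i == j)%:R.
  have -> : H = const_mx 1 + (q%:R ^+ 2 - 1)%:M.
    by apply/matrixP=> k l; rewrite EH !mxE mulr_natr.
  rewrite mulmxDr !mulmxDl mul_mx_scalar mul_scalar_mx -scalar_mxM !mxE.
  rewrite (eq_bigr (fun=> 1)) => [|k _]; last by rewrite !mxE mulr1.
  rewrite sumr_const card_ord -[_.+1%:R in LHS]natr1 natrX -mulr_natr; ring.
rewrite EH; ring.
Qed.

End PolyphaseETF.

(** * Phased designs that yield generalized quadrangles *)

(** Transfers an abstract incidence relation to ordinals along bijections. The single hypothesis
    that two points lie on at most one common line yields both intersection axioms, and also
    injectivity, because a block has s + 1 > 1 points. *)
Lemma is_GQ_incidence (P L : finType) (inc : L -> P -> bool) (s t v b : nat)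
    (fL : 'I_b -> L) (fP : 'I_v -> P) :
    (0 < s)%N -> (0 < t)%N -> bijective fL -> bijective fP ->
    (forall l, #|[set x | inc l x]| = s.+1) ->
    (forall x, #|[set l | inc l x]| = t.+1) ->
    (forall x y l m, x != y -> inc l x -> inc l y -> inc m x -> inc m y ->
      l = m) ->
    (forall x l, ~~ inc l x -> exists y m, [/\ inc l y, inc m y, inc m x &
      forall y' m', inc l y' -> inc m' y' -> inc m' x -> y' = y /\ m' = m]) ->
  is_GQ s t (fun r => [set c | inc (fL r) (fP c)]).
Proof.
move=> s_gt0 t_gt0 bL bP cardl cardx two ax.
have [[gL fLK gLK] [gP fPK gPK]] := (bL, bP).
have cardB r : #|[set c | inc (fL r) (fP c)]| = s.+1.
  rewrite -(cardl (fL r)) -[RHS](on_card_preimset (f := fP)).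
    by apply: eq_card => c; rewrite !inE.
  exact: onW_bij.
have two' c c' r r' : c != c' -> inc (fL r) (fP c) -> inc (fL r) (fP c') ->
    inc (fL r') (fP c) -> inc (fL r') (fP c') -> r = r'.
  move=> cc' h1 h2 h3 h4; apply: (can_inj fLK); apply: two h1 h2 h3 h4.
  by rewrite (can_eq fPK).
split=> //.
- move=> r r' /setP eqr.
  have /card_gt1P[c [c' [hc hc' cc']]] : (1 < #|[set c | inc (fL r) (fP c)]|)%N.
    by rewrite cardB ltnS.
  have [h1 h2] := (hc, hc'); rewrite !eqr in h1 h2.
  rewrite !inE in hc hc' h1 h2.
  exact: two' cc' hc hc' h1 h2.
- move=> c; rewrite -(cardx (fP c)) -[RHS](on_card_preimset (f := fL)).
    by apply: eq_card => r; rewrite !inE.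
  exact: onW_bij.
- move=> r r' rr'; rewrite leqNgt; apply: contraNN rr' => /card_gt1P[c [c' []]].
  by rewrite !inE => /andP[h1 h2] /andP[h3 h4] cc'; apply/eqP/(two' c c').
- move=> c c' cc'; rewrite leqNgt; apply/negP => /card_gt1P[r [r' []]].
  rewrite !inE => /andP[h1 h2] /andP[h3 h4]; apply/negP; rewrite negbK.
  by apply/eqP/(two' c c').
move=> c r; rewrite inE => /ax[y [m [h1 h2 h3 uniq]]].
exists (gP y, gL m); split; first by rewrite /= !inE gLK !gPK.
move=> [c' r'] /=; rewrite !inE => -[k1 k2 k3].
by have [<- <-] := uniq _ _ k1 k2 k3; rewrite fPK fLK.
Qed.

(** * The ETF and the quadrangle defined by a phase function *)

Section PhaseGQ.
Variables (C : numClosedFieldType) (q b : nat).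
Hypothesis q_gt1 : (1 < q)%N.
Variables (B : 'I_b -> {set 'I_(q ^ 3).+1}).
Variables (s : 'I_b -> 'I_(q ^ 3).+1 -> 'Z_q.+1).
Variable d : 'I_(q ^ 3).+1 -> 'I_(q ^ 3).+1 -> 'Z_q.+1.
Hypothesis BB : is_BIBD1 q.+1 B.
Hypothesis d_antisym : forall i j, d j i = - d i j.
Hypothesis s_diff :
  forall l i j, i \in B l -> j \in B l -> s l j - s l i = d i j.
Hypothesis d_inj :
  forall l i, i \notin B l -> {in B l &, injective (fun j => d i j - s l j)}.
Let Phi := phase_mx C B s.
Let G := 'Z_q.+1.

Let n_gt1 : (1 < q.+1)%N. Proof. exact: ltnW. Qed.

Let cardB l : #|B l| = q.+1. Proof. by have [] := BB. Qed.

Let cardG : #|{: G}| = q.+1. Proof. by rewrite card_ord Zp_cast. Qed.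

Let join i j : i != j -> exists l, [/\ i \in B l, j \in B l &
  forall m, i \in B m -> j \in B m -> m = l].
Proof.
have [_ _ _ uniqB] := BB; move=> /uniqB[l [[il jl] uniq]].
by exists l; split=> // m im jm; rewrite (uniq m).
Qed.

(** An injection from a block of q + 1 points into a group of order q + 1 is onto. *)
Let d_onto l i : i \notin B l -> [set d i j - s l j | j in B l] = [set: G].
Proof.
move=> il; apply/eqP; rewrite eqEcard subsetT cardsT cardG.
by rewrite (card_in_imset (d_inj il)) cardB leqnn.
Qed.

(** The (l, i) entry of M M^* M is a sum over the points j of l. If i is off l, then by [d_onto] the
    terms run through all values of [gamma] and cancel. If i is on l, the diagonal term is q^2
    gamma(s l i) and each of the q others equals gamma(s l i). *)
Lemma phase_ETF gamma :
  nontrivial_character gamma -> is_ETF (pp_eval gamma Phi).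
Proof.
move=> nontriv; have [chi _] := nontriv; have [gammaD _] := chi.
have offE i j : i != j ->
    (adjmx (pp_eval gamma Phi) *m pp_eval gamma Phi) i j = gamma (d i j).
  move=> ij; rewrite -pp_eval_gram // mxE.
  have [l [il jl ->]] := phase_gram_off C s BB ij.
  by rewrite gr_eval_monomial s_diff.
apply: (@ETF_intro _ _ _ _ (q ^ 2)%:R (q ^ 2 + q)%:R).
- by rewrite ltr0n expn_gt0 ltnW.
- by rewrite ltr0n addn_gt0 expn_gt0 ltnW.
- exact: eval_gram_diag.
- exact: eval_gram_off.
apply/matrixP=> l i; rewrite mxE [RHS]mxE pp_eval_phase_mx.
under eq_bigr => j _ do rewrite pp_eval_phase_mx -mulrA mulr_natl mulrb.
rewrite -big_mkcond /=; have [il | il] := boolP (i \in B l); last first.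
  rewrite mul0r mulr0.
  rewrite (eq_bigr (fun j => gamma (- (d i j - s l j)))) => [|j jl]; last first.
    have ji : j != i by apply: contraNneq il => <-.
    by rewrite offE // -gammaD d_antisym opprB.
  rewrite -(big_imset (fun g => gamma (- g)) (d_inj il)) d_onto //=.
  rewrite -[RHS](sum_nontrivial_character nontriv) [RHS](reindex_inj oppr_inj).
  by apply: eq_bigl => g; rewrite inE.
rewrite (bigD1 i) //= eval_gram_diag // (eq_bigr (fun=> gamma (s l i))).
  rewrite sumr_const mul1r natrD [RHS]mulrC mulrDr !mulr_natr; congr (_ + _ *+ _).
  transitivity #|B l :\ i|; first by apply: eq_card => j; rewrite !inE andbC.
  by have := cardB l; rewrite (cardsD1 i) il => -[].
move=> j /andP[jl ji]; rewrite offE // -gammaD -(s_diff jl il).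
by rewrite addrCA subrr addr0.
Qed.

(** The blocks [inl i] are the fibres over the vertices of the design, from the upper rows of the
    matrix. The block [inr (l, g)] is row g of the block row l of Phi(T), where T^h has its entry 1
    in column g - h. *)
Let inc (m : 'I_(q ^ 3).+1 + 'I_b * G) (x : 'I_(q ^ 3).+1 * G) : bool :=
  match m with
  | inl i => x.1 == i
  | inr (l, g) => (x.1 \in B l) && (x.2 == g - s l x.1)
  end.

Let card_inc_block m : #|[set x | inc m x]| = q.+1.
Proof.
case: m => [i | [l g]].
  transitivity #|[set (i, h) | h in [set: G]]|.
    apply: eq_card => -[j h]; rewrite inE /=.
    apply/eqP/imsetP => [-> | [h' _ [-> _]] //].
    by exists h; rewrite ?inE.
  by rewrite card_imset ?cardsT ?cardG // => h h' [].
transitivity #|[set (i, g - s l i) | i in B l]|; last first.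
  by rewrite card_imset ?cardB // => i j [].
apply: eq_card => -[j h]; rewrite inE /=.
by apply/andP/imsetP => [[jl /eqP->] | [i il [-> ->]]] //; exists j.
Qed.

Let card_inc_point x : #|[set m | inc m x]| = (q ^ 2).+1.
Proof.
case: x => i h; pose A := [set inr (l, h + s l i) | l in [set l | i \in B l]]
  : {set 'I_(q ^ 3).+1 + 'I_b * G}.
transitivity #|inl i |: A|.
  apply: eq_card => -[j | [l g]]; rewrite !inE /=.
    rewrite [inl j == _]eq_sym; case: eqP => [-> | ij]; first by rewrite eqxx.
    apply/esym; case: eqP => [[] /ij // | _]; by apply/negP=> /imsetP[].
  apply/andP/imsetP => [[il /eqP->] | [m]]; rewrite ?inE.
    by exists l; rewrite ?inE // subrK.
  by move=> im [-> ->]; rewrite im addrK.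
rewrite cardsU1 card_imset => [|l m [] //].
rewrite (unital_replication q_gt1 BB).
by rewrite (_ : _ \notin _) //; apply/negP=> /imsetP[].
Qed.

(** Two points of one fibre share only that fibre, as an [inr] block meets a fibre at most once.
    Points of different fibres determine l by the design and then g by either coordinate. *)
Let inc_two x y l m :
  x != y -> inc l x -> inc l y -> inc m x -> inc m y -> l = m.
Proof.
case: x y => [i h] [j k] xy.
have [eij | ij] := eqVneq i j.
  have same n : inc n (i, h) -> inc n (j, k) -> n = inl i.
    case: n => [n /eqP<- // | [n g]] /=; rewrite -eij => /andP[_ /eqP Dh].
    by move=> /andP[_ /eqP Dk]; case/eqP: xy; rewrite -eij Dh Dk.
  by move=> h1 h2 h3 h4; rewrite (same l) // (same m).
have [n [iN jN uniq]] := join ij.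
have same o : inc o (i, h) -> inc o (j, k) -> o = inr (n, h + s n i).
  case: o => [o /eqP Do /eqP Do' | [o g]] /=.
    by case/eqP: ij; move: Do Do' => /= -> ->.
  move=> /andP[io /eqP->] /andP[jo _].
  by rewrite (uniq o) // subrK.
by move=> h1 h2 h3 h4; rewrite (same l) // (same m).
Qed.

(** For a fibre, the connecting block comes from joining i to i0 in the design. For [inr (l, g)]
    with i on l, only the fibre over i connects. With i off l, connecting through the fibre over j
    means d i j - s l j = h - g, which has exactly one solution j on l. *)
Let inc_axiom x l : ~~ inc l x -> exists y m, [/\ inc l y, inc m y, inc m x &
  forall y' m', inc l y' -> inc m' y' -> inc m' x -> y' = y /\ m' = m].
Proof.
case: x l => [i h] [i0 /= ii0 | [l g] /= nlx].
  have [l [il i0l uniq]] := join ii0.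
  exists (i0, h + s l i - s l i0), (inr (l, h + s l i)).
  rewrite /= eqxx i0l il addrK !eqxx; split=> // -[j k] m /eqP /= ->.
  case: m => [m /= /eqP<- /eqP ei | [m g] /=]; first by rewrite ei eqxx in ii0.
  move=> /andP[i0m /eqP->] /andP[im /eqP->].
  by rewrite (uniq m) // subrK.
have [il | il] := boolP (i \in B l).
  rewrite il /= in nlx.
  exists (i, g - s l i), (inl i); rewrite /= il !eqxx; split=> // -[j k] m /=.
  move=> /andP[jl /eqP->]; case: m => [m /= /eqP-> /eqP-> // | [m g'] /=].
  move=> /andP[jm /eqP e] /andP[im /eqP Dh]; case/eqP: nlx; rewrite Dh.
  have [eji | ji] := eqVneq j i; first by rewrite -eji e.
  have [n [_ _ uniq]] := join ji.
  by move: e; rewrite (uniq m) // -(uniq l) // => /addIr->.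
have : h - g \in [set d i j - s l j | j in B l] by rewrite d_onto ?inE.
case/imsetP=> j jl Dj; have ij : i != j by apply: contraNneq il => ->.
have [n [iN jN uniq]] := join ij.
exists (j, g - s l j), (inr (n, h + s n i)).
rewrite /= jl eqxx jN iN addrK eqxx /=.
split=> //.
  have := s_diff iN jN => Dd.
  by apply/eqP; rewrite -[h](subrK g) Dj -Dd; ring.
move=> [j' k] m /= /andP[jl' /eqP->].
case: m => [m /= /eqP<- /eqP ei | [m g'] /=]; first by rewrite ei jl' in il.
move=> /andP[jm /eqP e] /andP[im /eqP Dh].
have ejj : j' = j.
  apply: (d_inj il) => //; rewrite -Dj -(s_diff im jm) Dh.
  by rewrite -[g in RHS](subrK (s l j')) e; ring.
by move: jm; rewrite ejj => jm; rewrite Dh (uniq m) // subrK.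
Qed.

Lemma phase_GQ : GQ_incidence q (q ^ 2) (abelian_GQ_mx Phi).
Proof.
(* [fP] and [fL] decode column and row indices of the matrix into abstract points and blocks. *)
pose fP (c : 'I_((q ^ 3).+1 * #|{: G}|)) : 'I_(q ^ 3).+1 * G :=
  ((mxtens_unindex c).1, enum_val (mxtens_unindex c).2).
pose fL (r : 'I_((q ^ 3).+1 * 1 + b * #|{: G}|)) : 'I_(q ^ 3).+1 + 'I_b * G :=
  match split r with
  | inl r1 => inl (mxtens_unindex r1).1
  | inr r2 => inr ((mxtens_unindex r2).1, enum_val (mxtens_unindex r2).2)
  end.
exists (fun r => [set c | inc (fL r) (fP c)]); split.
  apply: is_GQ_incidence; rewrite ?expn_gt0 ?(ltnW q_gt1) //.
  - exists (fun m => match m with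
      | inl i => lshift _ (mxtens_index (i, ord0))
      | inr (l, g) => rshift _ (mxtens_index (l, enum_rank g)) end).
      move=> r; rewrite /fL -[RHS]splitK; case: (split r) => r';
        rewrite -[r']mxtens_unindexK mxtens_indexK;
        case: (mxtens_unindex r') => i j /=; first by rewrite (ord1 j).
      by rewrite enum_valK.
    case=> [i | [l g]]; rewrite /fL.
      by rewrite (unsplitK (inl _)) mxtens_indexK.
    by rewrite (unsplitK (inr _)) mxtens_indexK /= enum_rankK.
  - exists (fun x => mxtens_index (x.1, enum_rank x.2)).
      move=> c; rewrite /fP -[RHS]mxtens_unindexK.
      by case: (mxtens_unindex c) => i g; rewrite enum_valK.
    by case=> i g; rewrite /fP mxtens_indexK /= enum_rankK.
apply/matrixP=> r c; rewrite [RHS]mxE inE /fL /fP mxE; case: split => r'.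
  by rewrite !mxE mulr1 eq_sym.
rewrite !mxE /=; case: (_ \in B _); rewrite /gr_mx summxE /=; last first.
  by rewrite big1 // => g _; rewrite !mxE ffunE mul0r.
set a := s _ _; rewrite (bigD1 a) //= big1 => [|g /negPf ga].
  by rewrite !mxE ffunE eqxx mul1r addr0.
by rewrite !mxE ffunE ga mul0r.
Qed.

End PhaseGQ.

(** * The Hermitian unital *)

Section QuadraticExtension.
Variables (K : finFieldType) (q : nat).
Hypothesis q_gt1 : (1 < q)%N.
Hypothesis cardK : #|K| = (q ^ 2)%N.

Let n_gt1 : (1 < q.+1)%N. Proof. exact: ltnW. Qed.
Let q_gt0 : (0 < q)%N. Proof. exact: ltnW. Qed.

Lemma frobenius_rmorphism : [pchar K].-nat q ->
  exists sigma : {rmorphism K -> K}, forall x, sigma x = x ^+ q.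
Proof.
move=> pq; have sD : zmod_morphism (fun x : K => x ^+ q).
  by move=> x y; rewrite exprDn_pchar // exprNn_pchar.
have sM : monoid_morphism (fun x : K => x ^+ q).
  by split=> [|x y]; rewrite ?expr1n ?exprMn.
pose mA := GRing.isZmodMorphism.Build _ _ (fun x : K => x ^+ q) sD.
pose mM := GRing.isMonoidMorphism.Build _ _ (fun x : K => x ^+ q) sM.
pose f : {rmorphism K -> K} := HB.pack (fun x : K => x ^+ q) mA mM.
by exists f.
Qed.

Variable sigma : {rmorphism K -> K}.
Hypothesis sigmaE : forall x, sigma x = x ^+ q.

Lemma frobenius_involutive : involutive sigma.
Proof. by move=> x; rewrite !sigmaE -exprM mulnn -cardK expf_card. Qed.

Lemma card_root_set (p : {poly K}) (A : {set K}) : p != 0 ->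
  (forall x, x \in A -> root p x) -> (#|A| < size p)%N.
Proof.
move=> p0 rA; rewrite cardE; apply: max_poly_roots; rewrite ?enum_uniq //.
by apply/allP=> x; rewrite mem_enum; apply: rA.
Qed.

Let size_trinom (a c : K) : size ('X^q + (a *: 'X + c%:P)) = q.+1.
Proof.
rewrite size_polyDl size_polyXn // ltnS; apply: leq_trans (size_polyD _ _) _.
rewrite geq_max (leq_trans (size_scale_leq _ _)) ?size_polyX //.
by apply: leq_trans (size_polyC_leq1 _) _.
Qed.

Let card_trinom_roots (a c : K) (A : {set K}) :
  (forall x, x \in A -> x ^+ q + (a * x + c) = 0) -> (#|A| <= q)%N.
Proof.
move=> rA; rewrite -ltnS -(size_trinom a c); apply: card_root_set => [|x xA].
  by rewrite -size_poly_eq0 size_trinom.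
by rewrite rootE !(hornerD, hornerXn, hornerZ, hornerX, hornerC) rA.
Qed.

(** Each trace fibre has at most q elements, the roots of X^q + X - d, and there are at most q
    fibres, indexed by the roots of X^q - X. They partition q^2 elements, so every bound is
    attained. *)
Lemma card_trace_fiber c : sigma c = c -> #|[set a | a + sigma a == c]| = q.
Proof.
move=> sc; pose fib d := [set a | a + sigma a == d].
have fib_le d : (#|fib d| <= q)%N.
  apply: (@card_trinom_roots 1 (- d)) => x; rewrite inE sigmaE mul1r => /eqP<-.
  by rewrite addrA [x ^+ q + x]addrC subrr.
pose Fix := [set d | sigma d == d].
have Fix_le : (#|Fix| <= q)%N.
  apply: (@card_trinom_roots (-1) 0) => x; rewrite inE sigmaE => /eqP->.
  by rewrite mulN1r addr0 subrr.
have total : (\sum_(d in Fix) #|fib d| = q ^ 2)%N.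
  rewrite -cardK -sum1_card.
  rewrite [RHS](partition_big (fun a => a + sigma a) (fun d => d \in Fix)) /=.
    apply: eq_bigr => d _; rewrite -sum1_card; apply: eq_bigl => a.
    by rewrite inE.
  by move=> a _; rewrite inE rmorphD /= frobenius_involutive addrC.
have cF : c \in Fix by rewrite inE sc.
apply/eqP; rewrite eqn_leq fib_le /= -(leq_add2r (q.-1 * q)) -mulSn prednK //.
rewrite mulnn -total (bigD1 c) //= leq_add2l.
apply: leq_trans (_ : \sum_(d in Fix | d != c) q <= _)%N.
  by apply: leq_sum => d _; apply: fib_le.
rewrite sum_nat_const leq_mul2r; apply/orP; right.
rewrite -ltnS prednK //; apply: leq_trans Fix_le.
rewrite [X in (_ < X)%N](cardD1 c) cF add1n ltnS subset_leq_card //.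
by apply/subsetP=> d; rewrite !inE => /andP[+ ->]; rewrite inE.
Qed.

(** Multiplication by [delta] turns trace zero into invariance under [sigma], a condition that [lg]
    detects. *)
Lemma exists_trace0 : exists2 delta, delta != 0 & sigma delta = - delta.
Proof.
have /card_gt1P[x [y [x0 y0 xy]]] :
    (1 < #|[set a : K | (a + sigma a == 0)%R]|)%N.
  by rewrite card_trace_fiber ?rmorph0.
rewrite !inE ![_ + sigma _]addrC !addr_eq0 in x0 y0.
exists (x - y); first by rewrite subr_eq0.
by rewrite rmorphB /= (eqP x0) (eqP y0) opprD.
Qed.

(** The logarithm to a primitive root w, reduced modulo q + 1, which divides the order q^2 - 1 of w.
    Moreover w^i is fixed by [sigma] iff q^2 - 1 divides i (q - 1), that is, iff q + 1 divides i. *)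
Lemma exists_log : exists lg : K -> 'Z_q.+1,
  {in [pred x | x != 0] &, {morph lg : x y / x * y >-> x + y}} /\
  {in [pred x | x != 0], forall x, (lg x == 0) = (sigma x == x)}.
Proof.
pose n := (q ^ 2).-1.
have Dn : n = (q.-1 * q.+1)%N.
  by rewrite /n -subn1 -(exp1n 2) subn_sqr subn1 addn1.
have n_gt0 : (0 < n)%N by rewrite Dn muln_gt0 -ltnS prednK // q_gt1.
have unityK (x : K) : x != 0 -> x ^+ n = 1.
  move=> x0; apply: (mulfI x0); rewrite -exprS prednK ?expn_gt0 ?q_gt0 //.
  by rewrite -cardK expf_card mulr1.
have [w pw] : exists w : K, n.-primitive_root w.
  have /hasP[w _ pw] : has n.-primitive_root (enum (predC1 (0 : K))).
    apply: has_prim_root; rewrite ?enum_uniq //.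
      by apply/allP=> x; rewrite mem_enum => /unityK xn; apply/unity_rootP.
    by rewrite -cardE cardC1 cardK.
  by exists w.
have powP x : x != 0 -> exists i, x = w ^+ i.
  by move/unityK/(prim_rootP pw)=> [i ->]; exists i.
pose lg x : 'Z_q.+1 :=
  if [pick i : 'I_n | x == w ^+ i] is Some i then i%:R else 0.
have ZpE i j : (i%:R == j%:R :> 'Z_q.+1) = (i == j %[mod q.+1]).
  by rewrite -val_eqE /= !val_Zp_nat.
have lgE i : lg (w ^+ i) = i%:R.
  rewrite /lg; case: pickP => [j | none].
    rewrite (eq_prim_root_expr pw) => /eqP ij; apply/eqP; rewrite ZpE.
    have dn : (q.+1 %| n)%N by rewrite Dn dvdn_mull.
    by rewrite -(modn_dvdm i dn) ij modn_dvdm.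
  have := none (Ordinal (ltn_pmod i n_gt0)).
  by rewrite /= prim_expr_mod // eqxx.
exists lg; split.
  move=> x y; rewrite !inE => /powP[i ->] /powP[j ->].
  by rewrite -exprD !lgE natrD.
move=> x; rewrite inE => /powP[i ->]; rewrite lgE sigmaE -exprM.
have := ZpE i 0; rewrite mod0n => ->; rewrite (eq_prim_root_expr pw).
rewrite eqn_mod_dvd ?leq_pmulr // -[X in (_ - X)%N]muln1 -mulnBr subn1 Dn.
by rewrite [(i * _)%N]mulnC dvdn_pmul2l // -ltnS prednK.
Qed.

End QuadraticExtension.

(** * Collinearity of isotropic points as a cocycle condition *)

Section HermitianUnital.
Variables (K : finFieldType) (q : nat) (sigma : {rmorphism K -> K}).
Hypothesis sigmaK : involutive sigma.
Hypothesis card_trace0 : #|[set a | a + sigma a == 0]| = q.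

Variables (delta : K) (lg : K -> 'Z_q.+1).
Hypothesis delta_neq0 : delta != 0.
Hypothesis sigma_delta : sigma delta = - delta.
Hypothesis lgM : {in [pred x | x != 0] &, {morph lg : x y / x * y >-> x + y}}.
Hypothesis lg_eq0 :
  {in [pred x | x != 0], forall x, (lg x == 0) = (sigma x == x)}.

Variables (V : lmodType K) (h : V -> V -> K).
Hypothesis hDl : forall a x y z, h (a *: x + y) z = a * h x z + h y z.
Hypothesis h_herm : forall x y, h y x = sigma (h x y).
Hypothesis witt_index1 : forall x y, h x x = 0 -> h y y = 0 -> h x y = 0 ->
  y != 0 -> exists c, x = c *: y.

Variables (I : finType) (p : I -> V).
Hypothesis p_neq0 : forall i, p i != 0.
Hypothesis p_iso : forall i, h (p i) (p i) = 0.
Hypothesis p_inj : forall i j c, p i = c *: p j -> i = j.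
Hypothesis p_all : forall x, x != 0 -> h x x = 0 -> exists i c, x = c *: p i.

Let h0l z : h 0 z = 0.
Proof. by have := hDl (-1) 0 0 z; rewrite scaler0 addr0 mulN1r addNr. Qed.

Let hZl a x z : h (a *: x) z = a * h x z.
Proof. by rewrite -[a *: x]addr0 hDl h0l addr0. Qed.

Let hDr a x y z : h z (a *: x + y) = sigma a * h z x + h z y.
Proof. by rewrite !(h_herm _ z) hDl rmorphD rmorphM. Qed.

Let hZr a x z : h z (a *: x) = sigma a * h z x.
Proof. by rewrite !(h_herm _ z) hZl rmorphM. Qed.

Let h_neq0 i j : i != j -> h (p i) (p j) != 0.
Proof.
apply: contraNneq => h0; apply/eqP.
by have [c /p_inj] := witt_index1 (p_iso i) (p_iso j) h0 (p_neq0 j).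
Qed.

Let sigma_eq0 x : (sigma x == 0) = (x == 0).
Proof. exact: fmorph_eq0. Qed.

Let lg_norm x : x != 0 -> lg (sigma x) = - lg x.
Proof.
move=> x0; apply/eqP; rewrite -addr_eq0 -lgM ?inE ?sigma_eq0 //.
by rewrite lg_eq0 ?inE ?mulf_neq0 ?sigma_eq0 // rmorphM /= sigmaK mulrC.
Qed.

Let lg_delta2 : lg delta + lg delta = 0.
Proof.
apply/eqP; rewrite -lgM ?inE // lg_eq0 ?inE ?mulf_neq0 //.
by rewrite rmorphM /= sigma_delta mulrNN.
Qed.

(* [lg] identifies K^* modulo the fixed field of [sigma] with Z_(q+1);
   [phase_diff i j] is the class of the scalars a such that a p_j is orthogonal
   to p_i for the trace form. *)
Definition phase_diff i j : 'Z_q.+1 :=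
  if i == j then 0 else lg (h (p i) (p j)) - lg delta.

Definition collinear i j k := phase_diff i j + phase_diff j k == phase_diff i k.

Lemma phase_diff_antisym i j : phase_diff j i = - phase_diff i j.
Proof.
rewrite /phase_diff [j == i]eq_sym.
case: eqVneq => [|ij]; first by rewrite oppr0.
rewrite (h_herm (p i)) lg_norm ?h_neq0 // opprB addrC; congr (_ - _).
by apply/eqP; rewrite eq_sym -addr_eq0 lg_delta2.
Qed.

(** Since 2 lg delta = 0, the phases around the triangle sum to lg (delta t), with t the triple
    product of the form. This vanishes iff delta t is fixed by [sigma], that is, iff t has trace
    zero. *)
Lemma collinear_trace i j k : i != j -> j != k -> i != k ->
  collinear i j k =
  (h (p i) (p j) * h (p j) (p k) * h (p k) (p i) +
   sigma (h (p i) (p j) * h (p j) (p k) * h (p k) (p i)) == 0).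
Proof.
move=> ij jk ik; have ki : k != i by rewrite eq_sym.
rewrite /collinear -subr_eq0 -[phase_diff i k]opprK -phase_diff_antisym opprK.
rewrite /phase_diff (negPf ij) (negPf jk) (negPf ki).
set x := h (p i) _; set y := h (p j) _; set z := h (p k) _.
have [x0 y0 z0] : [/\ x != 0, y != 0 & z != 0] by split; apply: h_neq0.
have -> : lg x - lg delta + (lg y - lg delta) + (lg z - lg delta) =
          lg (delta * (x * y * z)).
  rewrite !lgM ?inE ?mulf_neq0 //.
  transitivity (lg delta + (lg x + lg y + lg z) - 2 * (lg delta + lg delta)).
    by ring.
  by rewrite lg_delta2 mulr0 subr0.
rewrite lg_eq0 ?inE ?mulf_neq0 // rmorphM sigma_delta mulNr -mulrN.
rewrite (inj_eq (mulfI delta_neq0)) eq_sym.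
by rewrite -addr_eq0.
Qed.

(** Let n be the component of p_k orthogonal to p_i and p_j. Trace zero makes n orthogonal to p_k as
    well, hence isotropic; Witt index one makes it a multiple of p_i, and orthogonality to p_j makes
    it zero. Conversely, the trace is h(p_k, p_k) = 0 expanded and multiplied by h(p_i, p_j) h(p_j,
    p_i). *)
Lemma collinear_span i j k : i != j ->
  reflect (exists a c, p k = a *: p i + c *: p j) (collinear i j k).
Proof.
move=> ij; have ji : j != i by rewrite eq_sym.
have [x0 y0] := (h_neq0 ij, h_neq0 ji).
have [<-|jk] := eqVneq j k.
  apply: (iffP idP) => _; last by rewrite /collinear {2}/phase_diff eqxx addr0.
  by exists 0, 1; rewrite scale0r add0r scale1r.
have [<-|ik] := eqVneq i k.
  apply: (iffP idP) => _; last first.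
    by rewrite /collinear (phase_diff_antisym i j) subrr /phase_diff eqxx.
  by exists 1, 0; rewrite scale0r addr0 scale1r.
have [ki kj] : k != i /\ k != j by rewrite ![k == _]eq_sym.
rewrite collinear_trace //; apply: (iffP eqP) => [tr0 | [a [c Dk]]].
  pose a := h (p k) (p j) / h (p i) (p j).
  pose c := h (p k) (p i) / h (p j) (p i).
  pose n := p k - (a *: p i + c *: p j).
  exists a, c; apply/eqP; rewrite -subr_eq0 -/n; apply: contraTT isT => n0.
  have hn z : h n z = h (p k) z - (a * h (p i) z + c * h (p j) z).
    by rewrite /n -scaleN1r addrC hDl hDl hZl mulN1r addrC.
  have ni : h n (p i) = 0 by rewrite hn p_iso mulr0 add0r /c divfK ?subrr.
  have nj : h n (p j) = 0 by rewrite hn p_iso mulr0 addr0 /a divfK ?subrr.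
  have nk : h n (p k) = 0.
    rewrite hn p_iso sub0r /a /c; apply/eqP; rewrite oppr_eq0; apply/eqP.
    transitivity ((h (p k) (p j) * h (p j) (p i) * h (p i) (p k) +
       h (p i) (p j) * h (p j) (p k) * h (p k) (p i)) /
       (h (p i) (p j) * h (p j) (p i))); first by field; rewrite x0 y0.
    move: tr0; rewrite !rmorphM /= -!h_herm => tr0.
    by apply/eqP; rewrite mulf_eq0 -tr0; apply/orP; left; apply/eqP; ring.
  have nn : h n n = 0.
    rewrite {2}/n -scaleN1r addrC hDr hDr hZr ni nj nk !mulr0 !addr0.
    by rewrite mulr0.
  have [u nu] := witt_index1 nn (p_iso i) ni (p_neq0 i).
  have /eqP : h n (p j) = 0 := nj.
  rewrite nu hZl mulf_eq0 (negPf x0) orbF => /eqP u0.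
  by move: n0; rewrite nu u0 scale0r eqxx.
have hki : h (p k) (p i) = c * h (p j) (p i).
  by rewrite Dk hDl hZl p_iso mulr0 add0r.
have hkj : h (p k) (p j) = a * h (p i) (p j).
  by rewrite Dk hDl hZl p_iso mulr0 addr0.
have hjk : h (p j) (p k) = sigma a * h (p j) (p i).
  by rewrite h_herm hkj rmorphM -h_herm.
have := p_iso k; rewrite {2}Dk hDr hZr hki hkj => iso.
rewrite !rmorphM /= -!h_herm. rewrite hkj hjk.
transitivity (h (p i) (p j) * h (p j) (p i) *
  (sigma a * (c * h (p j) (p i)) + sigma c * (a * h (p i) (p j)))).
  by ring.
by rewrite iso mulr0.
Qed.

Lemma collinear_trans i j k l : i != j ->
  collinear i j k -> collinear i j l -> collinear i k l.
Proof.
move=> ij /(collinear_span _ ij)[a [c Dk]] /(collinear_span _ ij)[a' [c' Dl]].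
have [<-|ik] := eqVneq i k.
  by rewrite /collinear {1}/phase_diff eqxx add0r.
have c0 : c != 0.
  apply: contraNneq ik => c0; apply/eqP/esym/(@p_inj _ _ a).
  by rewrite Dk c0 scale0r addr0.
apply/(collinear_span _ ik); exists (a' - c' / c * a), (c' / c).
rewrite Dl Dk scalerDr !scalerA divfK // scalerBl.
by rewrite addrA subrK.
Qed.

(** A point a p_i + c p_j other than p_i has c != 0, and it is isotropic iff x = (a / c) h(p_i, p_j)
    has trace zero. The q possible x parametrize the line without p_i. *)
Lemma card_collinear i j : i != j -> #|[set k | collinear i j k]| = q.+1.
Proof.
move=> ij; have ji : j != i by rewrite eq_sym.
have [x0 y0] := (h_neq0 ij, h_neq0 ji).
have coli : collinear i j i.
  by rewrite /collinear (phase_diff_antisym i j) subrr /phase_diff eqxx.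
rewrite (cardsD1 i) inE coli add1n; congr _.+1.
(* This is the parameter x, expressed without a choice of a and c. *)
pose phi k := h (p k) (p j) * h (p j) (p i) / h (p k) (p i).
have phiE k a c : k != i -> p k = a *: p i + c *: p j ->
    c != 0 /\ phi k = a / c * h (p i) (p j).
  move=> ki Dk; have c0 : c != 0.
    apply: contraNneq ki => c0; apply/eqP/(@p_inj _ _ a).
    by rewrite Dk c0 scale0r addr0.
  split=> //; rewrite /phi Dk !hDl !hZl !p_iso !mulr0 add0r addr0.
  by field; rewrite c0 y0.
rewrite -card_trace0 -(card_in_imset (f := phi)); last first.
  move=> k k'; rewrite !inE => /andP[ki colk] /andP[ki' colk'].
  have [a [c Dk]] := collinear_span _ ij colk.
  have [a' [c' Dk']] := collinear_span _ ij colk'.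
  have [c0 ->] := phiE _ _ _ ki Dk; have [c0' ->] := phiE _ _ _ ki' Dk'.
  move/(mulIf x0) => eac; apply: (@p_inj _ _ (c / c')).
  rewrite Dk Dk' scalerDr !scalerA divfK //; congr (_ *: _ + _).
  by rewrite -mulrA [c'^-1 * _]mulrC -eac mulrC divfK.
apply: eq_card => x; rewrite inE; apply/imsetP/eqP => [[k] | trx].
  rewrite !inE => /andP[ki colk]; have [a [c Dk]] := collinear_span _ ij colk.
  have [c0 E] := phiE _ _ _ ki Dk => ->; rewrite E.
  have := p_iso k; rewrite Dk hDl hZl !hDr !hZr !p_iso (h_herm (p i) (p j)) => iso.
  have sc0 : sigma c != 0 by rewrite sigma_eq0.
  apply: (mulfI (mulf_neq0 c0 sc0)); rewrite mulr0 -iso !rmorphM fmorphV.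
  by field; rewrite c0 sc0.
pose y := (x / h (p i) (p j)) *: p i + p j.
have y_neq0 : y != 0.
  rewrite /y addrC addr_eq0; apply: contraNneq ji => Dj; apply/eqP.
  by apply: (@p_inj _ _ (- (x / h (p i) (p j)))); rewrite scaleNr.
have y_iso : h y y = 0.
  rewrite -[RHS]trx hDl !hDr !p_iso (h_herm (p i) (p j)) !rmorphM fmorphV.
  by field; rewrite sigma_eq0 x0.
have [k [c Dy]] := p_all y_neq0 y_iso.
have c0 : c != 0 by apply: contraNneq y_neq0 => c0; rewrite Dy c0 scale0r.
have Dk : p k = (c^-1 * (x / h (p i) (p j))) *: p i + c^-1 *: p j.
  by rewrite -scalerA -scalerDr -/y Dy scalerA mulVf ?scale1r.
have colk : collinear i j k.
  by apply/(collinear_span _ ij); do 2!eexists; exact: Dk.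
have ki : k != i.
  apply: contraNneq ji => ki; apply/eqP/(@p_inj _ _ (c - x / h (p i) (p j))).
  by rewrite scalerBl -ki -Dy ki /y addrAC subrr add0r.
exists k; first by rewrite !inE ki.
by have [_ ->] := phiE _ _ _ ki Dk; field; rewrite c0 x0 oner_eq0.
Qed.

End HermitianUnital.

(** * A Hermitian form in three variables and its unital *)

Section HermitianForm.
Variables (K : finFieldType) (q : nat) (sigma : {rmorphism K -> K}).
Hypothesis sigmaK : involutive sigma.
Hypothesis cardK : #|K| = (q ^ 2)%N.
Hypothesis card_fiber :
  forall c, sigma c = c -> #|[set a | a + sigma a == c]| = q.

Let V : lmodType K := (K^o * K^o * K^o)%type.

Definition hform (x y : K * K * K) : K :=
  x.1.1 * sigma y.2 + x.1.2 * sigma y.1.2 + x.2 * sigma y.1.1.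

Lemma hform_linear a (x y z : V) :
  hform (a *: x + y) z = a * hform x z + hform y z.
Proof.
case: x y z => [[x1 x2] x3] [[y1 y2] y3] [[z1 z2] z3]; rewrite /hform /=.
rewrite -![a *: _]/(a * _); ring.
Qed.

Lemma hform_herm x y : hform y x = sigma (hform x y).
Proof. by rewrite /hform !rmorphD !rmorphM /= !sigmaK; ring. Qed.

(** If y_3 = 0, both vectors are multiples of (1, 0, 0). Otherwise take c = x_3 / y_3: x - c y is
    isotropic with last coordinate 0, so its middle coordinate has norm 0, and orthogonality to y
    then kills the first. *)
Lemma hform_witt (x y : V) : hform x x = 0 -> hform y y = 0 ->
  hform x y = 0 -> y != 0 -> exists c, x = c *: y.
Proof.
move=> hxx hyy hxy; have := hform_herm x y; rewrite hxy rmorph0.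
have norm0 u : u * sigma u = 0 -> u = 0.
  by move/eqP; rewrite mulf_eq0 fmorph_eq0 orbb => /eqP.
move: x y hxx hyy hxy => [[x1 x2] x3] [[y1 y2] y3]; rewrite /hform /=.
have [-> | y3_neq0] := eqVneq y3 0.
  rewrite !(rmorph0, mulr0, mul0r, addr0, add0r) => hxx /norm0-> hxy _ y_neq0.
  have y1_neq0 : y1 != 0 by apply: contraNneq y_neq0 => ->.
  move: hxy; rewrite rmorph0 mulr0 add0r => /eqP.
  rewrite mulf_eq0 fmorph_eq0 (negPf y1_neq0) orbF => /eqP x3_0.
  move: hxx; rewrite x3_0 rmorph0 mulr0 mul0r add0r addr0 => /norm0->.
  by exists (x1 / y1); congr (_, _, _); rewrite -[_ *: _]/(_ * _) ?divfK ?mulr0.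
have [c ->] : exists c, x3 = c * y3 by exists (x3 / y3); rewrite divfK.
rewrite !rmorphM /= => hxx hyy hxy hyx _; exists c.
have x2E : x2 = c * y2.
  apply/eqP; rewrite -subr_eq0; apply/eqP/norm0; rewrite rmorphB rmorphM.
  (* The expression is h(x - c y, x - c y) expanded, with x_3 = c y_3. *)
  transitivity (
    (x1 * (sigma c * sigma y3) + x2 * sigma x2 + c * y3 * sigma x1)
    - c * (y1 * (sigma c * sigma y3) + y2 * sigma x2 + y3 * sigma x1)
    - sigma c * (x1 * sigma y3 + x2 * sigma y2 + c * y3 * sigma y1)
    + c * sigma c * (y1 * sigma y3 + y2 * sigma y2 + y3 * sigma y1)).
    by ring.
  by rewrite hxx hyy hxy hyx !mulr0 !subr0 addr0.
congr (_, _, _) => //; apply/eqP; rewrite -subr_eq0 -[c *: y1]/(c * y1).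
have /eqP : (x1 - c * y1) * sigma y3 = 0.
  transitivity ((x1 * sigma y3 + x2 * sigma y2 + c * y3 * sigma y1) -
    c * (y1 * sigma y3 + y2 * sigma y2 + y3 * sigma y1)); last first.
    by rewrite hxy hyy mulr0 subr0.
  by rewrite x2E; ring.
by rewrite mulf_eq0 fmorph_eq0 (negPf y3_neq0) orbF.
Qed.

(** One normalized vector per isotropic point: last nonzero coordinate 1. *)
Definition unital : {set K * K * K} :=
  (1, 0, 0) |: [set (ab.1, ab.2, 1) |
    ab in [set ab : K * K | ab.1 + sigma ab.1 == - (ab.2 * sigma ab.2)]].

(** Each of the q^2 values of b leaves a trace fibre of q values of a. *)
Lemma card_unital : #|unital| = (q ^ 3).+1.
Proof.
rewrite cardsU1 (_ : _ \notin _); last first.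
  by apply/negP=> /imsetP[ab _ [_ _ /esym/eqP]]; rewrite oner_eq0.
rewrite card_imset => [|[a b] [a' b'] [-> ->] //]; congr _.+1.
rewrite -sum1_card.
transitivity
    (\sum_(b : K) \sum_(a : K | (a + sigma a == - (b * sigma b))%R) 1)%N.
  rewrite (exchange_big_dep xpredT) //= pair_big_dep /=.
  by apply: eq_bigl => ab; rewrite inE.
rewrite (eq_bigr (fun=> q)) => [|b _]; last first.
  rewrite -[RHS](@card_fiber (- (b * sigma b))).
    by rewrite -sum1_card; apply: eq_bigl => a; rewrite inE.
  by rewrite rmorphN rmorphM /= sigmaK mulrC.
by rewrite sum_nat_const cardK -expnSr.
Qed.

Lemma unital_iso x : x \in unital -> hform x x = 0.
Proof.
rewrite in_setU1 => /orP[/eqP-> | /imsetP[[a b]]]; rewrite /hform /=.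
  by rewrite rmorph0 rmorph1 mulr0 !mul0r !addr0.
rewrite inE /= => /eqP ab -> /=; rewrite rmorph1 mulr1 mul1r addrAC ab.
by rewrite addNr.
Qed.

Lemma unital_neq0 x : x \in unital -> x != 0.
Proof.
rewrite in_setU1 => /orP[/eqP-> | /imsetP[ab _ ->]].
  by apply/eqP=> [[/eqP]]; rewrite oner_eq0.
by apply/eqP=> [[_ _ /eqP]]; rewrite oner_eq0.
Qed.

Lemma unital_inj (x y : V) c : x \in unital -> y \in unital ->
  x = c *: y -> x = y.
Proof.
rewrite !in_setU1 => /orP[/eqP-> | /imsetP[ab _ ->]];
  move=> /orP[/eqP-> | /imsetP[ab' _ ->]] //.
- case; rewrite -![c *: _]/(c * _) mulr1 => + _ /esym c0.
  by rewrite c0 mul0r => /eqP; rewrite oner_eq0.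
- by case=> _ _; rewrite -![c *: _]/(c * _) mulr0 => /eqP; rewrite oner_eq0.
case; rewrite -![c *: _]/(c * _) mulr1 => -> -> <-.
by rewrite !mul1r.
Qed.

Lemma unital_complete (x : V) : x != 0 -> hform x x = 0 ->
  exists y c, y \in unital /\ x = c *: (y : V).
Proof.
case: x => [[a b] e] x_neq0; rewrite /hform /=.
have [-> | e0] := eqVneq e 0.
  rewrite rmorph0 mulr0 mul0r add0r addr0 => /eqP.
  rewrite mulf_eq0 fmorph_eq0 orbb => /eqP->.
  exists (1, 0, 0), a; rewrite setU11; split=> //.
  by congr (_, _, _); rewrite -[_ *: _]/(_ * _) ?mulr1 ?mulr0.
move=> iso; exists (a / e, b / e, 1), e; split; last first.
  by congr (_, _, _); rewrite -[_ *: _]/(_ * _) ?mulr1 // mulrC divfK.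
apply/setU1P; right; apply/imsetP; exists (a / e, b / e) => //.
rewrite inE /= -addr_eq0 !rmorphM !fmorphV; apply/eqP.
have se0 : sigma e != 0 by rewrite fmorph_eq0.
apply: (mulfI (mulf_neq0 e0 se0)); rewrite mulr0 -iso.
by field; rewrite e0 se0.
Qed.

End HermitianForm.

(** Retains from the geometry only the phase function d; lines are recovered below from its cocycle
    condition. *)
Lemma exists_unital_cocycle q : prime_power q ->
  exists d : 'I_(q ^ 3).+1 -> 'I_(q ^ 3).+1 -> 'Z_q.+1,
  [/\ forall i, d i i = 0, forall i j, d j i = - d i j,
      forall i j k l, i != j -> d i j + d j k == d i k ->
        d i j + d j l == d i l -> d i k + d k l == d i l
    & forall i j, i != j -> #|[set k | d i j + d j k == d i k]| = q.+1].
Proof.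
case=> r [e [pr e_gt0 Dq]].
have q_gt1 : (1 < q)%N by rewrite Dq -(exp1n e) ltn_exp2r ?prime_gt1.
have e2_gt0 : (0 < e * 2)%N by rewrite muln_gt0 e_gt0.
have [K charK cardK] := pPrimePowerField pr e2_gt0.
rewrite expnM -Dq in cardK.
have [|sigma sigmaE] := @frobenius_rmorphism K q.
  by rewrite Dq (eq_pnat _ (pcharf_eq charK)) pnatX pnat_id.
have sK := frobenius_involutive cardK sigmaE.
have fibs := card_trace_fiber q_gt1 cardK sigmaE.
have [delta d0 sd] := exists_trace0 q_gt1 cardK sigmaE.
have [lg [lgM lg0]] := exists_log q_gt1 cardK sigmaE.
have cU := card_unital sK cardK fibs.
pose V : lmodType K := (K^o * K^o * K^o)%type.
pose p (i : 'I_(q ^ 3).+1) : V := enum_val (cast_ord (esym cU) i).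
have pU i : p i \in unital sigma by apply: enum_valP.
have pK y : y \in unital sigma -> exists i, p i = y.
  move=> yU; exists (cast_ord cU (enum_rank_in yU y)).
  by rewrite /p cast_ordK enum_rankK_in.
have p_inj i j c : p i = c *: p j -> i = j.
  move/(unital_inj (pU i) (pU j)) => eij.
  exact: cast_ord_inj (enum_val_inj eij).
have p_all (x : V) : x != 0 -> hform sigma x x = 0 ->
    exists i c, x = c *: p i.
  move=> x0 /(unital_complete x0)[y [c [/pK[i <-] Dx]]].
  by exists i, c.
have p0 i : p i != 0 by apply: unital_neq0 (pU i).
have piso i : hform sigma (p i) (p i) = 0 by apply: unital_iso.
have card0 := fibs 0 (rmorph0 _).
pose h : V -> V -> K := hform sigma.
have hDl a x y z : h (a *: x + y) z = a * h x z + h y z.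
  exact: hform_linear.
have hherm x y : h y x = sigma (h x y) by apply: hform_herm.
have hwitt x y : h x x = 0 -> h y y = 0 -> h x y = 0 -> y != 0 ->
    exists c, x = c *: y by apply: hform_witt.
exists (phase_diff delta lg h p); split.
- by move=> i; rewrite /phase_diff eqxx.
- exact: (phase_diff_antisym sK d0 sd lgM lg0 hherm hwitt p0 piso p_inj).
- exact: (collinear_trans sK d0 sd lgM lg0 hDl hherm hwitt p0 piso p_inj).
- exact: (card_collinear sK card0 d0 sd lgM lg0 hDl hherm hwitt p0 piso p_inj
            p_all).
Qed.

(** * The phased design of a cocycle *)

Section CocycleLines.
Variables (q : nat) (d : 'I_(q ^ 3).+1 -> 'I_(q ^ 3).+1 -> 'Z_q.+1).
Hypothesis q_gt1 : (1 < q)%N.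
Hypothesis d_diag : forall i, d i i = 0.
Hypothesis d_antisym : forall i j, d j i = - d i j.
Let col i j k := d i j + d j k == d i k.
Hypothesis col_trans : forall i j k l, i != j -> col i j k -> col i j l ->
  col i k l.
Let line i j := [set k | col i j k].
Hypothesis card_line : forall i j, i != j -> #|line i j| = q.+1.

Let mem_line i j : i \in line i j /\ j \in line i j.
Proof. by rewrite !inE /col (d_antisym i j) !d_diag subrr addr0 !eqxx. Qed.

(** All triples on a line satisfy the cocycle identity, so there d is the coboundary of its values
    from any one point of the line. *)
Let col_line i j k l m : i != j ->
  k \in line i j -> l \in line i j -> m \in line i j -> col k l m.
Proof.
rewrite !inE => ij ki li mi.
have /eqP kl := col_trans ij ki li; have /eqP km := col_trans ij ki mi.
have /eqP lm := col_trans ij li mi.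
by apply/eqP/(addrI (d i k)); rewrite addrA kl lm km.
Qed.

Let line_eq i j k l : i != j -> k != l ->
  k \in line i j -> l \in line i j -> line i j = line k l.
Proof.
move=> ij kl kL lL; apply/eqP; rewrite eqEcard !card_line // leqnn andbT.
by apply/subsetP=> m mL; rewrite inE; apply: (col_line ij).
Qed.

Let lines := [set L | [exists i, [exists j, (i != j) && (L == line i j)]]].
Let B (l : 'I_#|lines|) : {set 'I_(q ^ 3).+1} := enum_val l.

Let B_line l : exists i j, i != j /\ B l = line i j.
Proof.
have := enum_valP l; rewrite inE => /existsP[i /existsP[j /andP[ij /eqP DL]]].
by exists i, j.
Qed.

Let B_BIBD : is_BIBD1 q.+1 B.
Proof.
split.
- by rewrite !ltnS ltnW //= -[X in (X < _)%N]expn1 ltn_exp2l.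
- exact: enum_val_inj.
- by move=> l; have [i [j [ij ->]]] := B_line l; apply: card_line.
move=> x y xy; have lxy : line x y \in lines.
  rewrite inE; apply/existsP; exists x; apply/existsP; exists y.
  by rewrite xy eqxx.
exists (enum_rank_in lxy (line x y)); split.
  by rewrite /B enum_rankK_in //; apply: mem_line.
move=> l [xl yl]; apply: enum_val_inj; rewrite enum_rankK_in //.
rewrite -/(B l); move: xl yl; have [i [j [ij ->]]] := B_line l.
by move=> xl yl; apply/esym/line_eq.
Qed.

(** The default is never reached, blocks being nonempty. *)
Let base l := odflt ord0 [pick i in B l].

Let base_in l : base l \in B l.
Proof.
rewrite /base; case: pickP => //= noB.
by have [_ _ cardB _] := B_BIBD; have := cardB l; rewrite (eq_card0 noB).
Qed.

Let s l j := d (base l) j.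

Let s_diff l i j : i \in B l -> j \in B l -> s l j - s l i = d i j.
Proof.
have := base_in l; have [k [m [km ->]]] := B_line l => ol il jl.
by rewrite /s; have /eqP <- := col_line km ol il jl; rewrite addrC addKr.
Qed.

(* If the map took equal values at [j != j'], then [i] would be collinear with
   [j] and [j']. *)
Let d_inj l i : i \notin B l -> {in B l &, injective (fun j => d i j - s l j)}.
Proof.
move=> il j j' jl jl' /= eqd; apply: contraNeq il => jj'.
have djj' := s_diff jl jl'; have [k [m [km DB]]] := B_line l.
move: jl jl'; rewrite DB => jl jl'; rewrite (line_eq km jj' jl jl') inE.
apply/eqP; rewrite (d_antisym i j) (d_antisym i j') -djj'.
by rewrite -[d i j](subrK (s l j)) eqd; ring.
Qed.

Lemma polyphase_BIBD_GQ_exists (C : numClosedFieldType) :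
  exists b (Phi : 'M[group_ring C 'Z_q.+1]_(b, (q ^ 3).+1)),
    polyphase_BIBD_ETF q.+1 q.+1 Phi /\
    GQ_incidence q (q ^ 2) (abelian_GQ_mx Phi).
Proof.
exists #|lines|, (phase_mx C B s); split; last first.
  exact: (phase_GQ C q_gt1 B_BIBD s_diff d_inj).
split.
- by rewrite card_ord Zp_cast // ltnW.
- move=> l i; rewrite mxE; case: (_ \in _); [right | by left].
  by exists (s l i).
- by exists B; split=> //; apply: pp_abs2_phase_mx.
- move=> gamma; exact: (phase_ETF q_gt1 B_BIBD d_antisym s_diff d_inj).
Qed.

End CocycleLines.

(** For odd q the order q + 1 is even, so g |-> (-1)^g is well defined on Z_(q+1). *)
Lemma real_nontrivial_character (C : numClosedFieldType) q : (1 < q)%N ->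
  odd q -> exists2 gamma : 'Z_q.+1 -> C, nontrivial_character gamma &
    forall g, gamma g \is Num.real.
Proof.
move=> q_gt1 odd_q; exists (fun g => (-1) ^+ g) => [|g]; last first.
  by rewrite rpredX // rpredN1.
split.
  by apply: Zp_expr_character; [exact: ltnW | rewrite -signr_odd /= odd_q].
by exists 1; rewrite /= modn_small // expr1 eq_sym -addr_eq0 (pnatr_eq0 C 2).
Qed.

Theorem theorem5p2 (R : realType) (q : nat) (q_pp : prime_power q) :
  (exists (b : nat) (Phi : 'M[group_ring R[i] 'Z_q.+1]_(b, (q ^ 3).+1)),
     polyphase_BIBD_ETF q.+1 q.+1 Phi /\
     GQ_incidence q (q ^ 2) (abelian_GQ_mx Phi)) /\
  (forall (b : nat) (Phi : 'M[group_ring R[i] 'Z_q.+1]_(b, (q ^ 3).+1)),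
     polyphase_BIBD_ETF q.+1 q.+1 Phi ->
     GQ_incidence q (q ^ 2) (abelian_GQ_mx Phi) ->
     [/\ forall gamma : 'Z_q.+1 -> R[i], nontrivial_character gamma ->
           [/\ BIBD1_incidence q.+1 (abs2_mx (pp_eval gamma Phi)),
               is_ETF (pp_eval gamma Phi),
               \rank (pp_eval gamma Phi) = (q * (q ^ 2 - q + 1))%N
             & ((q ^ 3).+1 - \rank (pp_eval gamma Phi))%N = (q ^ 2 - q + 1)%N],
         odd q -> exists2 gamma : 'Z_q.+1 -> R[i], nontrivial_character gamma &
           real_mx (pp_eval gamma Phi) /\ is_ETF (pp_eval gamma Phi)
       & abelian_DRACKN q.+1 (q ^ 2 - 1)
           (pp_adjoint Phi *m Phi - ((q ^ 2)%:R)%:M)]).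
Proof.
have q_gt1 : (1 < q)%N.
  case: q_pp => p [e [p_pr e_gt0 ->]].
  by rewrite -(exp1n e) ltn_exp2r ?prime_gt1.
split.
  have [d [d_diag d_antisym col_trans card_line]] := exists_unital_cocycle q_pp.
  exact: (polyphase_BIBD_GQ_exists q_gt1 d_diag d_antisym col_trans card_line).
move=> b Phi [_ monPhi [B [BB absPhi]] etf] _.
have [s DPhi] := phase_mxP monPhi absPhi; rewrite DPhi in etf *.
split.
- move=> gamma nontriv; have [chi _] := nontriv.
  have rk := eval_rank q_gt1 BB chi (etf _ nontriv).
  split=> //; first by exists B; split=> //; apply: eval_abs2.
    exact: etf.
  rewrite rk; case: (q) => // e.
  have -> : (e.+1 ^ 2 - e.+1 = e.+1 * e)%N.
    by rewrite -{2}[e.+1]muln1 -mulnBr subn1.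
  (* With q = e + 1 this is q^3 + 1 = q (q^2 - q + 1) + (q^2 - q + 1). *)
  apply/eqP; rewrite -(eqn_add2r (e.+1 * (e.+1 * e + 1))) subnK.
    by apply/eqP; ring.
  have -> : ((e.+1 ^ 3).+1 = e.+1 * (e.+1 * e + 1) + (e.+1 * e + 1))%N by ring.
  exact: leq_addr.
- move=> odd_q.
  have [gamma nontriv real] := real_nontrivial_character R[i] q_gt1 odd_q.
  exists gamma => //; split; last exact: etf.
  by move=> l i; rewrite pp_eval_phase_mx rpredM ?rpred_nat.
exact: phase_DRACKN.
Qed.
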